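(* Suppose that $\sup_{x\in\mathbb{Z}^d}\langle x\rangle^{-2}\sum_{y\sim x}\omega(x,y)<\infty$. If $x\mapsto G^\omega(x,x)$ is not an $\mathcal{S}'$-function, then there are no probability measures $\mu$ that are stationary with respect to $(T_t)_{t\ge0}$ and supported on $\mathcal{S}'$.
   Context: Let $d\ge1$; $x\sim y$ means that $x,y\in\mathbb{Z}^d$ are nearest neighbours. The conductances $\omega=(\omega(x,y))_{x,y\in\mathbb{Z}^d}$ are non-negative, symmetric and vanish unless $x\sim y$. Standing assumption: the graph on $\mathbb{Z}^d$ whose edges are the pairs $\{x,y\}$ with $\omega(x,y)>0$ has exactly one infinite connected component, denoted $\mathcal{C}(\omega)$. The formal Laplacian is $(\Delta_\omega u)(x)=\sum_{y\sim x}\omega(x,y)[u(x)-u(y)]$. The variable speed random walk is the continuous-time Markov chain $(X_t)_{t\geq 0}$ on $\mathcal{C}(\omega)$ with generator $-\Delta_\omega$; it is non-explosive under the growth assumption, $p^\omega_t(x,y)=\mathbf{P}^\omega_x[X_t=y]$, and $G^\omega(x,y)=\int_0^\infty p_t^\omega(x,y)\,dt\in[0,\infty]$. If $G^\omega(x,x)=\infty$ for some $x$, then $x\mapsto G^\omega(x,x)$ is in particular not an $\mathcal{S}'$-function. Write $\langle x\rangle=(1+|x|^2)^{1/2}$. For $N\ge0$, $H_{\pm N}$ is the space of $f:\mathcal{C}(\omega)\to\mathbb{R}$ with $\sum_x\langle x\rangle^{\pm2N}|f(x)|^2<\infty$; $\mathcal{S}'=\bigcup_{N\ge0}H_{-N}$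 (functions of at most polynomial growth). Under the growth assumption, for every $\phi_0\in\mathcal{S}'$ the SDE $d\phi_t(x)=\sum_{y\sim x}\omega(x,y)(\phi_t(y)-\phi_t(x))\,dt+\sqrt2\,dB_t(x)$, $x\in\mathcal{C}(\omega)$ (with independent standard Brownian motions), has a unique adapted solution with continuous paths in some $H_{-N}$, namely $\phi_t(x)=\sum_yp^\omega_t(x,y)\phi_0(y)+\sqrt2\sum_y\int_0^tp^\omega_{t-s}(x,y)\,dB_s(y)$. Let $T_tF(\phi)=\mathbb{E}_\phi[F(\phi_t)]$ for bounded measurable $F:\mathcal{S}'\to\mathbb{R}$, where $\mathbb{E}_\phi$ is expectation for the solution with $\phi_0=\phi$. A probability measure $\mu$ on $\mathcal{S}'$ is stationary if $\int T_tF\,d\mu=\int F\,d\mu$ for all such $F$ and $t\ge0$. *)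

(* Defs.v *)
From HB Require Import structures.
From mathcomp Require Import all_boot all_order all_algebra.
From mathcomp Require Import all_classical all_reals all_analysis.
Set Implicit Arguments.
Unset Strict Implicit.
Unset Printing Implicit Defensive.
Import Order.TTheory GRing.Theory Num.Theory.
Import numFieldTopology.Exports numFieldNormedType.Exports.
Local Open Scope classical_set_scope.
Local Open Scope ring_scope.

Notation Zd d := 'rV[int]_d.

Definition nn (d : nat) (x y : Zd d) : bool :=
  \sum_(i < d) `|x ord0 i - y ord0 i| == 1.

(* <x> = (1 + |x|^2)^(1/2), with |.| the Euclidean norm. *)
Definition jbracket (R : realType) (d : nat) (x : Zd d) : R :=
  Num.sqrt (1 + \sum_(i < d) (x ord0 i)%:~R ^+ 2).

Definition conductances (R : realType) (d : nat) (w : Zd d -> Zd d -> R) :=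
  [/\ forall x y, 0 <= w x y,
      forall x y, w x y = w y x
    & forall x y, ~~ nn x y -> w x y = 0].

Definition component (R : realType) (d : nat) (w : Zd d -> Zd d -> R)
    (x : Zd d) : set (Zd d) :=
  [set y | exists2 p : seq (Zd d),
      path (fun a b => 0 < w a b) x p & y = last x p].

Definition infinite_component (R : realType) (d : nat)
    (w : Zd d -> Zd d -> R) (C : set (Zd d)) :=
  infinite_set C /\ exists x, C = component w x.

Definition unique_infinite_component (R : realType) (d : nat)
    (w : Zd d -> Zd d -> R) (C : set (Zd d)) :=
  infinite_component w C /\
  forall C', infinite_component w C' -> C' = C.

Definition growth_assumption (R : realType) (d : nat)
    (w : Zd d -> Zd d -> R) :=
  (ereal_sup [set ((jbracket R x) ^- 2 *
       \sum_(y \in [set y | nn x y]) w x y)%:E | x in [set: Zd d]] < +oo)%E.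

(* The neighbours of x outside C need not be summed over: C is a connected
   component, so they satisfy w x y = 0. *)
Definition laplacian (R : realType) (d : nat) (w : Zd d -> Zd d -> R)
    (C : set (Zd d)) (u : C -> R) (x : C) : R :=
  \sum_(y \in [set y : C | nn (val x) (val y)])
    w (val x) (val y) * (u x - u y).

Definition Hneg_norm2 (R : realType) (d : nat) (C : set (Zd d)) (N : nat)
    (f : C -> R) : \bar R :=
  (\esum_(x in [set: C])
    ((jbracket R (val x)) ^- (2 * N) * `|f x| ^+ 2)%:E)%E.

Definition Hneg (R : realType) (d : nat) (C : set (Zd d)) (N : nat) :
    set (C -> R) :=
  [set f | (Hneg_norm2 N f < +oo)%E].

Definition Sprime (R : realType) (d : nat) (C : set (Zd d)) : set (C -> R) :=
  \bigcup_N @Hneg R d C N.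

Lemma Sprime0 (R : realType) (d : nat) (C : set (Zd d)) :
  (fun=> 0 : R) \in @Sprime R d C.
Proof.
apply/mem_set; exists 0%N => //; rewrite /Hneg /Hneg_norm2 /=.
by rewrite esum1 ?ltry // => x _; rewrite normr0 expr0n /= mulr0.
Qed.

Definition tempered (R : realType) (d : nat) (C : set (Zd d)) : Type :=
  set_type (@Sprime R d C).

HB.instance Definition _ (R : realType) (d : nat) (C : set (Zd d)) :=
  Choice.on (@tempered R d C).
HB.instance Definition _ (R : realType) (d : nat) (C : set (Zd d)) :=
  isPointed.Build (@tempered R d C) (exist (fun f => f \in @Sprime R d C) _ (@Sprime0 R d C)).

Definition cylinders (R : realType) (d : nat) (C : set (Zd d)) :
    set (set (tempered R C)) :=
  [set A | exists x : C, exists2 E : set R,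
      measurable E & A = [set f | E (val f x)]].

(* S' with the sigma-algebra generated by the evaluations f |-> f x. *)
Definition SprimeType (R : realType) (d : nat) (C : set (Zd d)) :=
  g_sigma_algebraType (@cylinders R d C).

(* An extended-real valued function on C that is an S'-function. *)
Definition is_Sprime_function (R : realType) (d : nat) (C : set (Zd d))
    (g : C -> \bar R) :=
  exists2 f : C -> R, Sprime f & forall x, g x = (f x)%:E.

Definition transition (R : realType) (d : nat) (C : set (Zd d))
    (dX : measure_display) (OmX : measurableType dX)
    (PX : C -> probability OmX R) (X : R -> OmX -> C)
    (t : R) (x y : C) : \bar R :=
  PX x (X t @^-1` [set y]).

Definition past (R : realType) (T S : Type) (X : R -> T -> S) (s : R) :
    set (set T) :=
  <<s [set A | exists u : R, exists2 y : S,
         0 <= u <= s & A = X u @^-1` [set y]] >>.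

(* Variable speed random walk: a right-continuous Markov chain on the discrete
   space C, defined for all times, whose law started from x is PX x, and whose
   transition function has right derivative at 0 given by the matrix of
   - laplacian w. *)
Definition variable_speed_random_walk (R : realType) (d : nat)
    (w : Zd d -> Zd d -> R) (C : set (Zd d))
    (dX : measure_display) (OmX : measurableType dX)
    (PX : C -> probability OmX R) (X : R -> OmX -> C) :=
  [/\ forall (t : R) (y : C), 0 <= t -> measurable (X t @^-1` [set y]),
      forall x, PX x (X 0 @^-1` [set x]) = 1%E,
      forall om (t : R), 0 <= t -> \forall s \near t^'+, X s om = X t om,
      forall (x y z : C) (s t : R) (A : set OmX),
        0 <= s -> 0 <= t -> past X s A ->
        PX x (A `&` X s @^-1` [set y] `&` X (s + t) @^-1` [set z]) =
        (PX x (A `&` X s @^-1` [set y]) * transition PX X t y z)%E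
    & forall x y : C,
        (fine (transition PX X t x y) - (x == y)%:R) / t @[t --> 0^'+] -->
        - laplacian w (fun z : C => (z == y)%:R) x].

Definition green (R : realType) (d : nat) (C : set (Zd d))
    (dX : measure_display) (OmX : measurableType dX)
    (PX : C -> probability OmX R) (X : R -> OmX -> C) (x y : C) : \bar R :=
  (\int[@lebesgue_measure R]_(t in `[0%R, +oo[) transition PX X t x y)%E.

Definition filtration (R : realType) (dO : measure_display)
    (Om : measurableType dO) (Fil : R -> set (set Om)) :=
  [/\ forall t : R, 0 <= t -> sigma_algebra setT (Fil t),
      forall t : R, 0 <= t -> Fil t `<=` measurable
    & forall s t : R, 0 <= s -> s <= t -> Fil s `<=` Fil t].

Definition adapted (R : realType) (T : Type)
    (Fil : R -> set (set T)) (Y : R -> T -> R) :=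
  forall (t : R) (E : set R), 0 <= t -> measurable E -> Fil t (Y t @^-1` E).

(* Independent standard Brownian motions indexed by I, relative to Fil: on
   every time interval the increments are centred Gaussians of variance t - s,
   mutually independent over I and jointly independent of Fil s. *)
Definition independent_brownian_motions (R : realType)
    (dO : measure_display) (Om : measurableType dO) (P : probability Om R)
    (Fil : R -> set (set Om)) (I : choiceType) (B : I -> R -> Om -> R) :=
  [/\ forall x om, B x 0 om = 0,
      forall x om, {within `[0, +oo[, continuous (fun t => B x t om)},
      forall x, adapted Fil (B x)
    & forall (s t : R) (A : set Om) (xs : seq I) (E : I -> set R),
        0 <= s -> s < t -> Fil s A -> uniq xs ->
        (forall x, measurable (E x)) ->
        P (A `&` [set om | forall x, x \in xs -> E x (B x t om - B x s om)]) =
        (P A * \prod_(x <- xs) normal_prob 0 (Num.sqrt (t - s)) (E x))%E].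

Definition Hneg_continuous (R : realType) (d : nat) (C : set (Zd d)) (N : nat)
    (phi : R -> C -> R) :=
  forall t : R, 0 <= t -> Hneg N (phi t) /\
    Hneg_norm2 N (fun x => phi s x - phi t x)
      @[s --> within [set s : R | 0 <= s] (nbhs t)] --> 0%E.

(* The noise being additive, the SDE in integrated form involves no
   stochastic integral. *)
Definition sde_solution (R : realType) (d : nat) (w : Zd d -> Zd d -> R)
    (C : set (Zd d)) (dO : measure_display) (Om : measurableType dO)
    (P : probability Om R) (Fil : R -> set (set Om)) (B : C -> R -> Om -> R)
    (phi0 : SprimeType R C) (phi : R -> Om -> SprimeType R C) :=
  [/\ forall x : C, adapted Fil (fun t om => val (phi t om) x),
      exists N : nat, {ae P, forall om,
        Hneg_continuous N (fun t => val (phi t om))}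
    & {ae P, forall om, forall (x : C) (t : R), 0 <= t ->
        val (phi t om) x =
          val phi0 x
          + (\int[lebesgue_measure]_(s in `[0, t])
              (- laplacian w (val (phi s om)) x))
          + Num.sqrt 2 * B x t om}].

Definition semigroup (R : realType) (d : nat) (C : set (Zd d))
    (dO : measure_display) (Om : measurableType dO) (P : probability Om R)
    (Phi : SprimeType R C -> R -> Om -> SprimeType R C)
    (t : R) (F : SprimeType R C -> R) (phi : SprimeType R C) : R :=
  \int[P]_om F (Phi phi t om).

Definition stationary (R : realType) (d : nat) (C : set (Zd d))
    (T : R -> (SprimeType R C -> R) -> SprimeType R C -> R)
    (mu : probability (SprimeType R C) R) :=
  forall F : SprimeType R C -> R,
    measurable_fun setT F -> (exists M : R, forall phi, `|F phi| <= M) ->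
    forall t : R, 0 <= t -> \int[mu]_phi T t F phi = \int[mu]_phi F phi.

(* Main.v *)
(* For a deterministic initial state phi_T(x) is Gaussian, and its variance is
   I_T, the integral of s |-> p_s(x,x) over [0,2T]; hence
   |E cos(th phi_T(x))| <= exp(- k th^2 I_T). By stationarity the integral of
   cos(th phi(x)) under mu obeys the same bound. As mu is carried by S', some j
   gives most of the mass to {phi : |phi(x)| <= (j+1) <x>^(2j) for all x}; with
   th = 1 / ((j+1) <x>^(2j)) the integral stays away from 0, so that I_T is
   bounded by a polynomial in <x> uniformly in T, and G(x,x) is an S'-function.

   The Gaussian bound does not use the explicit solution. The equation, sampled
   at the times kT/M, is tested against a_j = A^j delta_x, where A is one Euler
   step of the heat equation killed outside the box of radius n. Summation by
   parts leaves a deterministic term, a sum of independent Gaussians of variance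
   (2T/M) sum_j |a_j|^2 = (2T/M) sum_j a_(2j)(x), the outflow through the boundary
   of the box, and a discretisation error, which vanishes as M -> oo. The outflow
   vanishes as n -> oo because sum_y <y>^(2m) a_j(y)^2 stays bounded for every m:
   under the growth assumption this weighted energy grows at most exponentially
   in time (the drift itself may be of order <x>^2, so moments of a_j in L^1
   could not be propagated). The same identity, applied to y |-> p_t(y,x), shows
   that a_(2j)(x) approximates p_(2jT/M)(x,x). *)
Require Import Defs.
From mathcomp Require Import all_boot all_order all_algebra.
From mathcomp Require Import all_classical all_reals all_analysis.
From mathcomp Require Import measurable_realfun ring lra zify.
Set Implicit Arguments.
Unset Strict Implicit.
Unset Printing Implicit Defensive.
Import Order.TTheory GRing.Theory Num.Theory.
Import numFieldTopology.Exports numFieldNormedType.Exports.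
Local Open Scope classical_set_scope.
Local Open Scope ring_scope.

(** * Explicit Euler scheme on a finite set *)

(** No moments of [mu] are available, so only bounded functionals are used: the error terms enter
    through a cosine, are truncated at 2, and vanish by bounded convergence. Taking the absolute
    value of the characteristic function turns the initial state into a mere phase; this is why the
    bound is uniform in [phi0] and can be integrated against [mu]. The test functions a_j are
    finitely supported, so the duality with the solution consists of finite sums along each path.
    The order of limits is forced: the rates may grow like <x>^2, hence the explicit scheme in the
    box of radius n is controlled only for steps below a threshold depending on n. So M tends to
    infinity with n fixed, and n afterwards; the second limit succeeds because the weighted bounds
    on a_j do not depend on n. Only an upper bound of p_t(x,x) by the scheme is used, since it is a
    lower bound on the variance that makes the characteristic function small. *)

Section euler_scheme.
Variables (R : realType) (I : eqType) (s s' : seq I) (W : I -> I -> R).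
Hypotheses (us : uniq s) (us' : uniq s') (ss' : {subset s <= s'}).
Hypotheses (W0 : forall y z, 0 <= W y z) (WC : forall y z, W y z = W z y).
Implicit Types (a u b : I -> R) (y z : I).

(** The scheme lives on [s]; [s'] is a larger finite set, later chosen to contain all neighbours of
    [s]. For a function supported in [s] this gives the Dirichlet Laplacian, since the edges to [s']
    outside [s] still contribute killing. *)
Definition lap u y : R := \sum_(z <- s') W y z * (u y - u z).

Definition euler (dt : R) a y : R := if y \in s then a y - dt * lap a y else 0.

(** The boundary term of Green's formula: the flux of [a] across the edges leaving [s], weighted by
    [u] at their outer endpoints. *)
Definition outflow a u : R :=
  \sum_(y <- s) \sum_(z <- s' | z \notin s) a y * W y z * u z.

Definition dirac_fun (x y : I) : R := (y == x)%:R.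

Definition supported a := forall y, y \notin s -> a y = 0.

Lemma sum_inside_outside (F : I -> R) :
  \sum_(z <- s') F z = \sum_(z <- s) F z + \sum_(z <- s' | z \notin s) F z.
Proof.
rewrite (bigID (mem s)) /=; congr (_ + _).
rewrite -big_filter; apply: perm_big; apply: uniq_perm => //.
  exact: filter_uniq.
move=> z; rewrite mem_filter; apply/andP/idP => [[]//|zs].
by split => //; exact: ss'.
Qed.

Lemma euler_supported dt a : supported (euler dt a).
Proof. by move=> y ys; rewrite /euler (negbTE ys). Qed.

Lemma iter_euler_supported dt a j : supported a -> supported (iter j (euler dt) a).
Proof. by case: j => //= j _; exact: euler_supported. Qed.

(** Green's formula. The diagonal parts agree, and the part of the double sum with both endpoints in
    [s] is symmetric by [WC]; what remains are the edges leaving [s], seen from one side only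
    because [a] vanishes outside. *)
Lemma sum_lap a u : supported a ->
  \sum_(y <- s) a y * lap u y = \sum_(y <- s) lap a y * u y - outflow a u.
Proof.
move=> a0; apply/eqP; rewrite eq_sym subr_eq; apply/eqP.
have -> : \sum_(y <- s) lap a y * u y =
  \sum_(y <- s) \sum_(z <- s') W y z * a y * u y
  - \sum_(y <- s) \sum_(z <- s) W y z * a z * u y.
  rewrite -sumrB; apply: eq_bigr => y _.
  rewrite /lap mulr_suml.
  rewrite (_ : \sum_(z <- s) _ = \sum_(z <- s') W y z * a z * u y); last first.
    rewrite [RHS]sum_inside_outside [X in _ + X]big1 ?addr0// => z zs.
    by rewrite a0// mulr0 mul0r.
  by rewrite -sumrB; apply: eq_bigr => z _; ring.
have -> : \sum_(y <- s) a y * lap u y =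
  \sum_(y <- s) \sum_(z <- s') W y z * a y * u y
  - \sum_(y <- s) \sum_(z <- s) W y z * a y * u z - outflow a u.
  rewrite -!sumrB; apply: eq_bigr => y _.
  rewrite -addrA -opprD.
  rewrite (_ : _ + \sum_(z <- s' | _) _ = \sum_(z <- s') W y z * a y * u z).
    by rewrite /lap mulr_sumr -sumrB; apply: eq_bigr => z _; ring.
  rewrite [RHS]sum_inside_outside; congr (_ + _).
  by apply: eq_bigr => z _; ring.
rewrite subrK; congr (_ - _); rewrite exchange_big /=.
by apply: eq_bigr => y _; apply: eq_bigr => z _; rewrite WC.
Qed.

(** Duality: a free Euler step on [u] becomes a killed Euler step on [a], at the price of the mass
    lost through the boundary. *)
Lemma sum_euler_step dt a u : supported a ->
  \sum_(y <- s) a y * (u y - dt * lap u y) =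
  \sum_(y <- s) euler dt a y * u y + dt * outflow a u.
Proof.
move=> a0.
have -> : \sum_(y <- s) a y * (u y - dt * lap u y) =
    \sum_(y <- s) a y * u y - dt * \sum_(y <- s) a y * lap u y.
  by rewrite mulr_sumr -sumrB; apply: eq_bigr => y _; ring.
have -> : \sum_(y <- s) euler dt a y * u y =
    \sum_(y <- s) a y * u y - dt * \sum_(y <- s) lap a y * u y.
  rewrite mulr_sumr -sumrB big_seq [RHS]big_seq; apply: eq_bigr => y ys.
  by rewrite /euler ys; ring.
by rewrite sum_lap//; ring.
Qed.

Lemma outflow_supported a b : supported b -> outflow a b = 0.
Proof.
by move=> b0; rewrite /outflow big1// => y _; rewrite big1// => z zs; rewrite b0// mulr0.
Qed.

Lemma euler_sym dt a b : supported a -> supported b ->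
  \sum_(y <- s) euler dt a y * b y = \sum_(y <- s) a y * euler dt b y.
Proof.
move=> a0 b0.
have := sum_euler_step dt b a0; rewrite outflow_supported// mulr0 addr0 => <-.
rewrite big_seq [RHS]big_seq; apply: eq_bigr => y ys.
by rewrite /euler ys.
Qed.

Lemma dirac_fun_supported x : x \in s -> supported (dirac_fun x).
Proof.
by move=> xs y ys; rewrite /dirac_fun; case: eqP => // yx; rewrite yx xs in ys.
Qed.

Lemma sum_dirac_fun x u : x \in s -> \sum_(y <- s) dirac_fun x y * u y = u x.
Proof.
move=> xs; rewrite (bigD1_seq x)//= /dirac_fun eqxx mul1r big1 ?addr0// => y yx.
by rewrite (negbTE yx) mul0r.
Qed.

(** The killed step A is self-adjoint, so the pairing of A^j delta_x with itself is that of delta_x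
    with A^(2j) delta_x. This is how a variance becomes a return probability at twice the time. *)
Lemma sum_iter_euler_sqr dt x j : x \in s ->
  \sum_(y <- s) iter j (euler dt) (dirac_fun x) y ^+ 2 =
  iter j.*2 (euler dt) (dirac_fun x) x.
Proof.
move=> xs; have d0 := dirac_fun_supported xs.
rewrite -[RHS](@sum_dirac_fun _ (iter _ _ _))// -addnn.
suff H i k : \sum_(y <- s) iter i (euler dt) (dirac_fun x) y *
    iter k (euler dt) (dirac_fun x) y =
    \sum_(y <- s) dirac_fun x y * iter (i + k) (euler dt) (dirac_fun x) y.
  by rewrite -H; apply: eq_bigr => y _; rewrite expr2.
elim: i k => // i IH k; rewrite iterS euler_sym ?addSnnS -?IH//;
  exact: iter_euler_supported.
Qed.

Lemma sum_sym_ge0 (F : I -> I -> R) :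
  {in s &, forall y z, 0 <= F y z + F z y} ->
  0 <= \sum_(y <- s) \sum_(z <- s) F y z.
Proof.
move=> F0; set S := (X in 0 <= X).
suff : 0 <= S + S by rewrite -mulr2n pmulrn_lge0.
rewrite {2}/S exchange_big /S -big_split /= big_seq; apply: sumr_ge0 => y ys.
by rewrite -big_split /= big_seq; apply: sumr_ge0 => z zs; exact: F0.
Qed.

(** * Growth of the weighted energy along the Euler iterates *)

Section energy.
Variables (psi : I -> R) (c : R).
Hypothesis psi1 : {in s, forall y, 1 <= psi y}.
Hypothesis psic : {in s, forall y,
  \sum_(z <- s) W y z * (psi y - psi z) ^+ 2 <= c * psi y ^+ 2}.

Let energy a := \sum_(y <- s) psi y ^+ 2 * a y ^+ 2.

(* The square completion behind this bound is
   2(p^2 a - q^2 b)(a - b) + (a^2 + b^2)(p - q)^2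
   = 2(p a - q b)^2 + (a - b)^2 (p - q)^2. *)
Lemma energy_dissipation a : supported a ->
  - (c * energy a) <= 2 * \sum_(y <- s) psi y ^+ 2 * a y * lap a y.
Proof.
move=> a0; rewrite lerNl -subr_ge0 opprK addrC.
apply: (@le_trans _ _ (\sum_(y <- s) \sum_(z <- s)
   W y z * (2 * psi y ^+ 2 * a y * (a y - a z) + a y ^+ 2 * (psi y - psi z) ^+ 2))).
  apply: sum_sym_ge0 => y z ys zs; rewrite (WC z y) -mulrDr mulr_ge0//.
  have -> : 2 * psi y ^+ 2 * a y * (a y - a z) + a y ^+ 2 * (psi y - psi z) ^+ 2 +
    (2 * psi z ^+ 2 * a z * (a z - a y) + a z ^+ 2 * (psi z - psi y) ^+ 2) =
    2 * (psi y * a y - psi z * a z) ^+ 2 + (a y - a z) ^+ 2 * (psi y - psi z) ^+ 2.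
    by ring.
  by rewrite addr_ge0// mulr_ge0// sqr_ge0.
rewrite /energy !mulr_sumr -big_split /= big_seq [leRHS]big_seq.
apply: ler_sum => y ys.
have -> : \sum_(z <- s) W y z * (2 * psi y ^+ 2 * a y * (a y - a z) +
     a y ^+ 2 * (psi y - psi z) ^+ 2) =
   2 * (psi y ^+ 2 * a y * \sum_(z <- s) W y z * (a y - a z)) +
   a y ^+ 2 * \sum_(z <- s) W y z * (psi y - psi z) ^+ 2.
  by rewrite !mulr_sumr -big_split /=; apply: eq_bigr => z _; ring.
apply: lerD.
  rewrite ler_pM2l// /lap sum_inside_outside mulrDr lerDl mulr_sumr.
  apply: sumr_ge0 => z zs; rewrite (a0 z)// subr0.
  have -> : psi y ^+ 2 * a y * (W y z * a y) = W y z * (psi y * a y) ^+ 2 by ring.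
  by rewrite mulr_ge0 ?sqr_ge0.
rewrite [leRHS](_ : _ = a y ^+ 2 * (c * psi y ^+ 2)); last by ring.
by rewrite ler_wpM2l ?sqr_ge0// psic.
Qed.

(** A crude bound for the squared weighted norm of [lap]. It depends on [s] and may be huge, so it
    is allowed to enter only through the step condition [dt * Q <= 1]. *)
Let Q := \sum_(y <- s) psi y ^+ 2 * (2 * \sum_(z <- s') W y z) ^+ 2.

Lemma le_energy a y : supported a -> psi y ^+ 2 * a y ^+ 2 <= energy a.
Proof.
move=> a0; have [ys|/a0->] := boolP (y \in s).
  rewrite /energy (bigD1_seq y)//= lerDl sumr_ge0// => z _.
  by rewrite mulr_ge0// sqr_ge0.
by rewrite expr0n mulr0 sumr_ge0// => z _; rewrite mulr_ge0// sqr_ge0.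
Qed.

(** Since [psi >= 1] on [s], the square of the supremum of [a] is at most the energy; and [lap a y]
    is at most twice the supremum times the total weight at [y]. *)
Lemma energy_lap a : supported a ->
  \sum_(y <- s) psi y ^+ 2 * lap a y ^+ 2 <= Q * energy a.
Proof.
move=> a0; have E0 : 0 <= energy a.
  by apply: sumr_ge0 => z _; rewrite mulr_ge0// sqr_ge0.
have aE z : `|a z| <= Num.sqrt (energy a).
  have [zs|zs] := boolP (z \in s); last by rewrite a0// normr0 sqrtr_ge0.
  rewrite -sqrtr_sqr ler_wsqrtr//; apply: le_trans (le_energy z a0).
  by rewrite ler_peMl ?sqr_ge0// exprn_ege1// psi1.
rewrite /Q mulr_suml; apply: ler_sum => y _.
rewrite -mulrA ler_wpM2l ?sqr_ge0//.
rewrite -(sqr_sqrtr E0) -exprMn -[leLHS]real_normK ?num_real//.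
rewrite lerXn2r ?nnegrE// ?mulr_ge0 ?sumr_ge0 ?sqrtr_ge0//.
apply: le_trans (ler_norm_sum _ _ _) _.
rewrite mulr_sumr mulr_suml; apply: ler_sum => z _.
rewrite normrM ger0_norm// [leRHS](_ : _ = W y z * (Num.sqrt (energy a) + Num.sqrt (energy a))); last by ring.
by rewrite ler_wpM2l// (le_trans (ler_normB _ _))// lerD.
Qed.

(** In the expanded square the cross term costs [dt * c] by [energy_dissipation], and the term in
    [dt ^+ 2] costs at most [dt] by the step condition; hence the rate [c + 1], free of [Q]. *)
Lemma energy_euler dt a : 0 <= dt -> dt * Q <= 1 -> supported a ->
  energy (euler dt a) <= (1 + dt * (c + 1)) * energy a.
Proof.
move=> dt0 dtQ a0; have E0 : 0 <= energy a.
  by apply: sumr_ge0 => z _; rewrite mulr_ge0// sqr_ge0.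
have -> : energy (euler dt a) = energy a
   - dt * (2 * \sum_(y <- s) psi y ^+ 2 * a y * lap a y)
   + dt ^+ 2 * \sum_(y <- s) psi y ^+ 2 * lap a y ^+ 2.
  rewrite /energy !mulr_sumr -sumrB -big_split /= big_seq [RHS]big_seq.
  by apply: eq_bigr => y ys; rewrite /euler ys; ring.
have H1 := energy_dissipation a0.
have H2 := energy_lap a0.
have H3 := ler_wpM2l dt0 H1.
have H4 : dt ^+ 2 * (\sum_(y <- s) psi y ^+ 2 * lap a y ^+ 2) <= dt * energy a.
  rewrite expr2 -mulrA ler_wpM2l//; apply: le_trans (ler_wpM2l dt0 H2) _.
  by rewrite mulrA ler_piMl.
lra.
Qed.

(** Discrete Gronwall, followed by bounding one term by the whole energy. The exponential rate
    depends on [s] only through [c], which will be the same for all boxes. *)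
Lemma iter_euler_bound dt x j y : 0 <= c -> 0 <= dt -> dt * Q <= 1 -> x \in s ->
  (psi y * iter j (euler dt) (dirac_fun x) y) ^+ 2 <=
  expR (dt * j%:R * (c + 1)) * psi x ^+ 2.
Proof.
move=> c0 dt0 dtQ xs; have d0 := dirac_fun_supported xs.
rewrite exprMn; apply: le_trans (le_energy y (iter_euler_supported dt j d0)) _.
have Ed : energy (dirac_fun x) = psi x ^+ 2.
  rewrite /energy -[RHS](@sum_dirac_fun _ (fun x => psi x ^+ 2) xs).
  apply: eq_bigr => z _; rewrite mulrC /dirac_fun.
  by case: eqP => _; rewrite ?expr1n ?expr0n.
rewrite -Ed; elim: j => [|j IH].
  by rewrite mulr0 mul0r expR0 mul1r.
rewrite iterS; apply: le_trans (energy_euler dt0 dtQ (iter_euler_supported dt j d0)) _.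
rewrite [X in expR X](_ : _ = dt * (c + 1) + dt * j%:R * (c + 1)); last first.
  by rewrite -natr1; ring.
rewrite expRD -mulrA ler_pM//.
- by rewrite addr_ge0// mulr_ge0// addr_ge0.
- by rewrite /energy sumr_ge0// => z _; rewrite mulr_ge0// sqr_ge0.
- exact: expR_ge1Dx.
Qed.

End energy.

(** Discrete Duhamel formula with source [b] and error [r]. What is injected at step [k] is
    propagated by the remaining [m - k.+1] killed steps. *)
Lemma euler_telescope dt x (u b r : nat -> I -> R) m : x \in s ->
  (forall k y, (k < m)%N -> y \in s ->
     u k.+1 y = u k y - dt * lap (u k) y + b k y + r k y) ->
  let a j := iter j (euler dt) (dirac_fun x) in
  u m x = \sum_(y <- s) a m y * u 0%N y
    + \sum_(k < m) (dt * outflow (a (m - k.+1)%N) (u k))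
    + \sum_(k < m) \sum_(y <- s) a (m - k.+1)%N y * b k y
    + \sum_(k < m) \sum_(y <- s) a (m - k.+1)%N y * r k y.
Proof.
move=> xs ustep a.
have aS j : supported (a j) by apply: iter_euler_supported; exact: dirac_fun_supported.
(* The forward evolution of [u] paired with the backward evolution of [a]: it equals [u m x] at
   [n = m] and the initial pairing at [n = 0], and changes only by boundary, source and error
   terms. *)
pose S n := \sum_(y <- s) a (m - n)%N y * u n y.
have -> : u m x = S m by rewrite /S subnn /= sum_dirac_fun.
have -> : \sum_(y <- s) a m y * u 0%N y = S 0%N by rewrite /S subn0.
suff H n : (n <= m)%N -> S n = S 0%N
    + \sum_(k < n) (dt * outflow (a (m - k.+1)%N) (u k))
    + \sum_(k < n) \sum_(y <- s) a (m - k.+1)%N y * b k y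
    + \sum_(k < n) \sum_(y <- s) a (m - k.+1)%N y * r k y by exact: H.
elim: n => [_|n IH nm]; first by rewrite !big_ord0 !addr0.
rewrite !big_ord_recr /=.
have -> : S n.+1 = S n + dt * outflow (a (m - n.+1)%N) (u n)
   + \sum_(y <- s) a (m - n.+1)%N y * b n y
   + \sum_(y <- s) a (m - n.+1)%N y * r n y.
  rewrite /S -(subnSK nm) [a (_.+1)]/(euler dt (a (m - n.+1)%N)) -sum_euler_step//.
  rewrite -!big_split /= big_seq [RHS]big_seq; apply: eq_bigr => y ys.
  by rewrite ustep//; ring.
by rewrite IH 1?ltnW//; ring.
Qed.

End euler_scheme.

(** * Geometry of the lattice *)

Lemma sum_uniq_sub (R : numDomainType) (I : eqType) (s s' : seq I) (F : I -> R) :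
  uniq s -> uniq s' -> {subset s <= s'} -> (forall i, 0 <= F i) ->
  \sum_(i <- s) F i <= \sum_(i <- s') F i.
Proof.
move=> us us' ss' F0; rewrite [leRHS](bigID (mem s)) /=.
rewrite (_ : \sum_(i <- s) F i = \sum_(i <- s' | i \in s) F i).
  by rewrite lerDl sumr_ge0.
rewrite -[RHS]big_filter; apply: perm_big; apply: uniq_perm => //.
  exact: filter_uniq.
move=> z; rewrite mem_filter; apply/idP/andP => [zs|[]//].
by split => //; exact: ss'.
Qed.

Section lattice.
Variables (R : realType) (d : nat).
Implicit Types x y z : Zd d.

Definition bracket2 y : R := 1 + \sum_(i < d) (y ord0 i)%:~R ^+ 2.

Lemma bracket2_ge1 y : 1 <= bracket2 y.
Proof. by rewrite lerDl sumr_ge0// => i _; rewrite sqr_ge0. Qed.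

Lemma bracket2_gt0 y : 0 < bracket2 y.
Proof. exact: lt_le_trans (bracket2_ge1 y). Qed.

Lemma jbracket_sqr y : jbracket R y ^+ 2 = bracket2 y.
Proof. by rewrite /jbracket sqr_sqrtr// ltW// bracket2_gt0. Qed.

Lemma coord_le_bracket2 y i : 1 + (y ord0 i)%:~R ^+ 2 <= bracket2 y.
Proof.
rewrite /bracket2 (bigD1 i)//= lerD2l lerDl sumr_ge0// => j _.
by rewrite sqr_ge0.
Qed.

Lemma nn_coord x y : nn x y -> exists i : 'I_d,
  `|x ord0 i - y ord0 i| = 1 /\ forall j, j != i -> x ord0 j = y ord0 j.
Proof.
move=> /eqP xy.
have [/existsP[i xyi]|/existsPn H] := boolP [exists i, x ord0 i != y ord0 i]; last first.
  move: xy; rewrite big1// => i _.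
  by have /negPn/eqP -> := H i; rewrite subrr normr0.
exists i; move: xy; rewrite (bigD1 i)//=.
have S0 j : j != i -> 0 <= `|x ord0 j - y ord0 j| <= \sum_(j < d | j != i) `|x ord0 j - y ord0 j|.
  move=> ji; rewrite normr_ge0/= (bigD1 j)//= lerDl sumr_ge0// => *.
set S := \sum_(j < d | j != i) _ in S0 *.
have : 0 <= S by rewrite /S sumr_ge0.
move=> S_0 xy; have xi : 1 <= `|x ord0 i - y ord0 i| by lia.
split; first lia.
by move=> j ji; have := S0 j ji; lia.
Qed.

Lemma nn_coord_le x y i : nn x y -> `|y ord0 i| <= `|x ord0 i| + 1.
Proof.
move=> /nn_coord[j [xyj xyn]]; have [->|/xyn] := eqVneq i j; lia.
Qed.

Lemma nn_bracket2_sub x y : nn x y ->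
  exists i, bracket2 y - bracket2 x = (y ord0 i)%:~R ^+ 2 - (x ord0 i)%:~R ^+ 2 /\
  `|(x ord0 i)%:~R - (y ord0 i)%:~R| = 1 :> R.
Proof.
move=> /nn_coord[i [xyi xyn]]; exists i; split; last first.
  by rewrite -intrB -intr_norm xyi.
rewrite /bracket2 (bigD1 i)//= [X in _ - (_ + X)](bigD1 i)//=.
rewrite (eq_bigr (fun j => (x ord0 j)%:~R ^+ 2)); last by move=> j /xyn ->.
ring.
Qed.

(** One coordinate a changes by 1 in absolute value, so <x>^2 changes by 2a+1 or 1-2a: this is of
    order <x> only. The gain of one power of <x> is what compensates rates of order <x>^2. *)
Lemma nn_bracket2_sub_sqr x y : nn x y ->
  (bracket2 y - bracket2 x) ^+ 2 <= 8 * bracket2 x.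
Proof.
move=> /nn_bracket2_sub[i [-> ]].
have := coord_le_bracket2 x i.
set a := (x ord0 i)%:~R; set b := (y ord0 i)%:~R => Hx Hab.
have -> : b ^+ 2 - a ^+ 2 = (b - a) * (b - a) + 2 * a * (b - a) by ring.
have : (b - a = 1) \/ (b - a = -1).
  by move: Hab; have [?|?] := ger0P (a - b); lra.
have h1 := sqr_ge0 (a - 1); have h2 := sqr_ge0 (a + 1).
by move: h1 h2; rewrite !expr2 => h1 h2 [] ->; move: Hx; rewrite expr2; nra.
Qed.

Lemma nn_bracket2_le x y : nn x y -> bracket2 y <= 4 * bracket2 x.
Proof.
move=> /nn_bracket2_sub_sqr H; have V1 := bracket2_ge1 x.
rewrite leNgt; apply/negP => lt; move: H.
rewrite leNgt => /negP; apply.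
have : 3 * bracket2 x < bracket2 y - bracket2 x by lra.
set D := bracket2 y - _ => HD; rewrite expr2; nra.
Qed.

(** Discrete form of the fact that the gradient of <x>^(2M) is of order <x>^(2M-1); the factor
    [bracket2 x] on the left is the room left for the degree bound. Induction by the product
    rule. *)
Lemma nn_bracket2_exp_sub_sqr M : exists2 D : R, 0 <= D &
  forall x y, nn x y ->
    bracket2 x * (bracket2 y ^+ M - bracket2 x ^+ M) ^+ 2 <= D * (bracket2 x ^+ M) ^+ 2.
Proof.
elim: M => [|M [D D0 IH]].
  by exists 0 => // x y _; rewrite !expr0 subrr expr0n mulr0 mul0r.
(* After (p + q)^2 <= 2 p^2 + 2 q^2, the bound b <= 4a turns D into 2 * 16 * D, and (b - a)^2 <= 8a
   gives 2 * 8. *)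
exists (32 * D + 16); first by lra.
move=> x y xy; have := IH x y xy.
have := nn_bracket2_le xy; have := nn_bracket2_sub_sqr xy.
have := bracket2_ge1 x; have := bracket2_ge1 y.
rewrite ![_ ^+ M.+1]exprS.
move: (bracket2 x) (bracket2 y) => a b b1 a1 ab ba.
set A := a ^+ M; set B := b ^+ M => H.
have -> : b * B - a * A = b * (B - A) + (b - a) * A by ring.
have H1 : (b * (B - A) + (b - a) * A) ^+ 2 <=
    2 * (b ^+ 2 * (B - A) ^+ 2) + 2 * ((b - a) ^+ 2 * A ^+ 2).
  by have := sqr_ge0 (b * (B - A) - (b - a) * A); lra.
apply: le_trans (ler_wpM2l _ H1) _; first by lra.
have H2 : b ^+ 2 * (a * (B - A) ^+ 2) <= 16 * a ^+ 2 * (D * A ^+ 2).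
  apply: ler_pM => //; first exact: sqr_ge0.
    by rewrite mulr_ge0// ?sqr_ge0//; lra.
  by rewrite [leRHS](_ : _ = (4 * a) ^+ 2); [rewrite lerXn2r ?nnegrE//; lra | ring].
have H3 : (b - a) ^+ 2 * A ^+ 2 <= 8 * a * A ^+ 2.
  by rewrite ler_wpM2r ?sqr_ge0.
have H4 : a * ((b - a) ^+ 2 * A ^+ 2) <= a * (8 * a * A ^+ 2).
  by rewrite ler_wpM2l//; lra.
nra.
Qed.

Lemma sum_inv_sqr (n : nat) :
  \sum_(k < n.*2.+1) (1 + ((k%:Z - n%:Z)%:~R : R) ^+ 2)^-1 <= 8.
Proof.
(* A bounded function whose increment over each unit step between integers dominates (1 + z^2)^(-1);
   the sum telescopes and is at most twice the bound 4. *)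
pose h (t : R) := 4 * t / (1 + `|t|).
have h4 t : `|h t| <= 4.
  rewrite /h normrM normfV ler_pdivrMr ?normr_gt0 ?gt_eqF ?ltr_pwDl//.
  rewrite normrM (ger0_norm (_ : 0 <= 4))// (ger0_norm (_ : 0 <= 1 + `|t|)) ?addr_ge0//.
  by rewrite ler_wpM2l// lerDr.
suff H m : \sum_(k < m) (1 + ((k%:Z - n%:Z)%:~R : R) ^+ 2)^-1 <=
    h ((m%:Z - n%:Z)%:~R) - h ((0%:Z - n%:Z)%:~R).
  apply: le_trans (H _) _; move: (h4 ((n.*2.+1)%:Z - n%:Z)%:~R) (h4 (0%:Z - n%:Z)%:~R).
  by rewrite !ler_norml; lra.
elim: m => [|m IH]; first by rewrite big_ord0 subrr.
rewrite big_ord_recr /=; apply: le_trans (lerD IH (lexx _)) _.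
rewrite addrAC lerD2r.
have -> : (m.+1%:Z - n%:Z)%:~R = (m%:Z - n%:Z)%:~R + 1 :> R.
  by rewrite -(intrD _ _ 1); congr (_%:~R); lia.
rewrite addrC -lerBrDr.
suff : forall z : int, (1 + (z%:~R : R) ^+ 2)^-1 <= h (z%:~R + 1) - h z%:~R by exact.
move=> z; have [z0|z0] := lerP 0 z.
  have : 0 <= z%:~R :> R by rewrite ler0z.
  move: (z%:~R : R) => t t0; rewrite /h !ger0_norm; [|lra..].
  have -> : 4 * (t + 1) / (1 + (t + 1)) - 4 * t / (1 + t) = 4 / ((t + 1) * (t + 2)).
    by field; rewrite !gt_eqF//; lra.
  rewrite ler_pdivlMr; last by nra.
  rewrite mulrC ler_pdivrMr ?ltr_pwDl ?sqr_ge0//.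
  by have := sqr_ge0 (2 * t - 1); lra.
have : z%:~R <= -1 :> R by rewrite (_ : -1 = (-1)%:~R)// ler_int; lia.
move: (z%:~R : R) => t t0; rewrite /h !ler0_norm; [|lra..].
have -> : 4 * (t + 1) / (1 + - (t + 1)) - 4 * t / (1 + - t) = 4 / (t * (t - 1)).
  by field; do ?[apply/andP; split]; apply/eqP; lra.
rewrite ler_pdivlMr; last by nra.
rewrite mulrC ler_pdivrMr ?ltr_pwDl ?sqr_ge0//.
by have := sqr_ge0 (2 * t + 1); lra.
Qed.

(** The sup-norm ball. Indexing it by finite functions makes a sum of products over the coordinates
    factor into one-dimensional sums. *)
Definition zbox (n : nat) : seq (Zd d) :=
  [seq \row_i ((f i : nat)%:Z - n%:Z) | f : {ffun 'I_d -> 'I_(n.*2.+1)}].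

Lemma zbox_inj n : injective (fun f : {ffun 'I_d -> 'I_(n.*2.+1)} =>
  \row_i ((f i : nat)%:Z - n%:Z)).
Proof.
move=> f g /rowP fg; apply/ffunP => i; apply/val_inj.
by have := fg i; rewrite !mxE => /addIr[].
Qed.

Lemma zbox_uniq n : uniq (zbox n).
Proof. by rewrite map_inj_uniq ?enum_uniq//; exact: zbox_inj. Qed.

Lemma mem_zbox n y : (y \in zbox n) = [forall i, `|y ord0 i| <= n%:Z].
Proof.
apply/mapP/forallP => [[f _ ->] i|H].
  by rewrite !mxE; move: (nat_of_ord (f i)) (ltn_ord (f i)) => k; lia.
have L i : (absz (y ord0 i + n%:Z)%R < n.*2.+1)%N by have := H i; lia.
exists [ffun i => Ordinal (L i)]; first by rewrite mem_enum.
apply/rowP => i; rewrite !mxE ffunE /= gez0_abs; first by rewrite addrK.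
by have := H i; lia.
Qed.

Lemma zbox_nn n x y : x \in zbox n -> nn x y -> y \in zbox n.+1.
Proof.
rewrite !mem_zbox => /forallP H xy; apply/forallP => i.
by have := H i; have := nn_coord_le i xy; lia.
Qed.

Lemma mem_zbox_ex y : exists n, forall m, (n <= m)%N -> y \in zbox m.
Proof.
exists (\sum_i `|y ord0 i|%N)%N => m; rewrite (bigID predT) /= [X in (_ + X)%N]big_pred0 ?addn0// => ym.
rewrite mem_zbox; apply/forallP => i; move: ym; rewrite (bigD1 i)//=; lia.
Qed.

Lemma zbox_bracket2 n y : y \notin zbox n -> 1 + n.+1%:R ^+ 2 <= bracket2 y.
Proof.
rewrite mem_zbox => /forallPn[i]; rewrite -ltNge => H.
apply: le_trans (coord_le_bracket2 y i); rewrite lerD2l.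
rewrite -[leRHS]real_normK ?num_real// -intr_norm lerXn2r ?nnegrE//.
by rewrite -[leLHS]/(n.+1%:Z%:~R) ler_int; lia.
Qed.

(** Each factor 1 + y_i^2 is at most <y>^2, so <y>^(-2d) is at most the product of the d inverses,
    whose sum over the box factors into d one-dimensional sums. *)
Lemma sum_zbox_bracket2 n : \sum_(y <- zbox n) (bracket2 y ^+ d)^-1 <= 8 ^+ d.
Proof.
rewrite big_map /=.
apply: (@le_trans _ _ (\sum_(f : {ffun 'I_d -> 'I_(n.*2.+1)})
   \prod_i (1 + (((f i : nat)%:Z - n%:Z)%:~R : R) ^+ 2)^-1)).
  rewrite [leLHS]big_enum; apply: ler_sum => f _.
  rewrite prodfV lef_pV2 ?posrE; last 2 first.
  - by rewrite exprn_gt0 ?bracket2_gt0.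
  - by rewrite prodr_gt0// => i _; rewrite ltr_pwDl// sqr_ge0.
  rewrite -[X in _ ^+ X](card_ord d) -prodr_const; apply: ler_prod => i _.
  rewrite addr_ge0 ?sqr_ge0//=.
  by apply: le_trans (coord_le_bracket2 _ i); rewrite mxE.
rewrite -(bigA_distr_bigA (fun (i : 'I_d) (k : 'I_(n.*2.+1)) =>
  (1 + ((k%:Z - n%:Z)%:~R : R) ^+ 2)^-1)).
rewrite prodr_const card_ord lerXn2r ?nnegrE// ?sum_inv_sqr//.
by rewrite sumr_ge0// => i _; rewrite invr_ge0 addr_ge0 ?sqr_ge0.
Qed.

(** * Boxes and weights on a subset of the lattice *)

Section subset_box.
Variable C : set (Zd d).

Definition box (n : nat) : seq C := pmap insub (zbox n).

Lemma box_uniq n : uniq (box n).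
Proof. by rewrite /box pmap_sub_uniq ?zbox_uniq. Qed.

Lemma mem_box n (y : C) : (y \in box n) = (val y \in zbox n).
Proof. by rewrite /box mem_pmap_sub. Qed.

Lemma mem_box_ex (y : C) : exists n, forall m, (n <= m)%N -> y \in box m.
Proof.
by have [n H] := mem_zbox_ex (val y); exists n => m nm; rewrite mem_box H.
Qed.

Lemma box_sub n m : (n <= m)%N -> {subset box n <= box m}.
Proof.
move=> nm y; rewrite !mem_box !mem_zbox => /forallP H; apply/forallP => i.
by have := H i; lia.
Qed.

Lemma box_nn n (x y : C) : x \in box n -> nn (val x) (val y) -> y \in box n.+1.
Proof. by rewrite !mem_box; exact: zbox_nn. Qed.

Lemma seq_sub_box (s : seq C) : exists n, {subset s <= box n}.
Proof.
elim: s => [|y s [n IH]]; first by exists 0%N.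
have [m Hm] := mem_box_ex y; exists (maxn n m) => z.
rewrite inE => /orP[/eqP->|/IH]; first by rewrite Hm// leq_maxr.
by apply: box_sub; rewrite leq_maxl.
Qed.

Lemma sum_box_bracket2 n : \sum_(y <- box n) (bracket2 (val y) ^+ d)^-1 <= 8 ^+ d.
Proof.
apply: le_trans (sum_zbox_bracket2 n).
rewrite -(big_map val predT (fun y => (bracket2 y ^+ d)^-1)).
apply: sum_uniq_sub.
- by rewrite map_inj_uniq ?box_uniq//; exact: val_inj.
- exact: zbox_uniq.
- by move=> _ /mapP[y + ->]; rewrite mem_box.
- by move=> y; rewrite invr_ge0 exprn_ge0// ltW// bracket2_gt0.
Qed.

Variables (w : Zd d -> Zd d -> R).
Hypothesis cw : conductances w.

Let W (y z : C) := w (val y) (val z).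

Lemma nn_set_seq x n : x \in zbox n ->
  [set y | nn x y] = [set` [seq y <- zbox n.+1 | nn x y]].
Proof.
move=> xn; apply/seteqP; split => y /=.
  by move=> xy; rewrite mem_filter xy (zbox_nn xn xy).
by rewrite mem_filter => /andP[].
Qed.

Lemma laplacianE n (u : C -> R) (y : C) : y \in box n ->
  laplacian w u y = lap (box n.+1) W u y.
Proof.
move=> yn; rewrite /laplacian /lap.
rewrite (_ : [set z : C | _] = [set` [seq z <- box n.+1 | nn (val y) (val z)]]); last first.
  apply/seteqP; split => z /=.
    by move=> yz; rewrite mem_filter yz (box_nn yn yz).
  by rewrite mem_filter => /andP[].
rewrite -fsbig_seq ?filter_uniq ?box_uniq// big_filter big_mkcond /=.
apply: eq_bigr => z _; case: ifPn => // yz.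
by have [_ _ wnn] := cw; rewrite /W wnn// mul0r.
Qed.

Lemma growth_degree : growth_assumption w -> exists2 c : R, 0 <= c &
  forall (y : C) (s : seq C), uniq s -> \sum_(z <- s) W y z <= c * bracket2 (val y).
Proof.
move=> gw.
have [c Hc] : exists c : R, forall x : Zd d,
   (jbracket R x) ^- 2 * (\sum_(y \in [set y | nn x y]) w x y) <= c.
  move: gw; rewrite /growth_assumption.
  set S := [set _ | x in _].
  have HS x : S ((jbracket R x) ^- 2 * \sum_(y \in [set y | nn x y]) w x y)%:E by exists x.
  case E : (ereal_sup S) => [c| |]// _.
    exists c => x; rewrite -lee_fin -E; exact: ereal_sup_ubound.
  by exists 0 => x; have := ereal_sup_ubound (HS x); rewrite E leeNy_eq.
exists `|c| => // y s us.
have [n /(_ _ (leqnn n)) yn] := mem_zbox_ex (val y).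
apply: (@le_trans _ _ (c * bracket2 (val y))); last first.
  by rewrite ler_wpM2r ?ler_norm// ltW// bracket2_gt0.
have := Hc (val y); rewrite jbracket_sqr mulrC ler_pdivrMr ?bracket2_gt0//.
apply: le_trans.
rewrite (nn_set_seq yn) -fsbig_seq ?filter_uniq ?zbox_uniq//.
have [w0 _ wnn] := cw.
rewrite /W -(big_map val predT (fun z => w (val y) z)).
rewrite (bigID (nn (val y))) /= [X in _ + X]big1 ?addr0; last by move=> z /wnn.
rewrite -big_filter; apply: sum_uniq_sub.
- by rewrite filter_uniq// map_inj_uniq//; exact: val_inj.
- by rewrite filter_uniq ?zbox_uniq.
- move=> z; rewrite !mem_filter => /andP[yz _]; rewrite yz.
  exact: zbox_nn yn yz.
- by move=> z; exact: w0.
Qed.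

(** The degree bound c <y>^2 meets the factor <y>^2 gained in [nn_bracket2_exp_sub_sqr]. This
    supplies the hypothesis [psic] of the energy estimate with a constant independent of the box. *)
Lemma weight_gradient M : growth_assumption w -> exists2 c : R, 0 <= c &
  forall n (y : C), \sum_(z <- box n) W y z *
    (bracket2 (val y) ^+ M - bracket2 (val z) ^+ M) ^+ 2 <=
    c * (bracket2 (val y) ^+ M) ^+ 2.
Proof.
move=> /growth_degree[c c0 Hc]; have [D D0 HD] := nn_bracket2_exp_sub_sqr M.
have [w0 _ wnn] := cw.
exists (c * D) => [|n y]; first exact: mulr_ge0.
have V0 := bracket2_gt0 (val y).
rewrite -(ler_pM2l V0) mulr_sumr.
apply: (@le_trans _ _ (\sum_(z <- box n) W y z * (D * (bracket2 (val y) ^+ M) ^+ 2))).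
  apply: ler_sum => z _; rewrite mulrCA.
  have [yz|/wnn E] := boolP (nn (val y) (val z)); last by rewrite /W E !mul0r.
  by rewrite ler_wpM2l ?w0// -sqrrN opprB HD.
rewrite -mulr_suml.
apply: le_trans (ler_wpM2r _ (Hc y _ (box_uniq n))) _.
  by rewrite mulr_ge0// sqr_ge0.
by rewrite le_eqVlt; apply/orP; left; apply/eqP; ring.
Qed.

End subset_box.
End lattice.

(** * The killed Euler kernel *)

Section kernel.
Variables (R : realType) (d : nat) (w : Zd d -> Zd d -> R) (C : set (Zd d)).
Hypotheses (cw : conductances w) (gw : growth_assumption w).

Definition edge_weight (y z : C) : R := w (val y) (val z).

(* Explicit Euler approximation, with step dt, of the heat kernel killed
   outside box n. *)
Definition euler_kernel n dt (x : C) j : C -> R :=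
  iter j (euler (box C n) (box C n.+1) edge_weight dt) (dirac_fun R x).

Definition box_outflow n : (C -> R) -> (C -> R) -> R :=
  outflow (box C n) (box C n.+1) edge_weight.

Let W0 y z : 0 <= edge_weight y z. Proof. by have [w0 _ _] := cw; exact: w0. Qed.
Let WC y z : edge_weight y z = edge_weight z y.
Proof. by have [_ wC _] := cw; exact: wC. Qed.

(** The order of the quantifiers is the point: [E] comes before the box, whereas the step threshold
    [q] may depend on it. *)
Lemma kernel_weighted_bound M T (x : C) : exists2 E : R, 0 <= E &
  forall n, x \in box C n -> exists2 q : R, 0 < q &
    forall (dt : R) j, 0 <= dt -> dt * q <= 1 -> dt * j%:R <= T ->
    forall y : C, `|euler_kernel n dt x j y| * bracket2 R (val y) ^+ M <= E.
Proof.
have [c c0 Hc] := @weight_gradient R d C w cw M gw.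
pose psi (y : C) := bracket2 R (val y) ^+ M.
have psi1 n : {in box C n, forall y, 1 <= psi y}.
  by move=> y _; rewrite /psi exprn_ege1// bracket2_ge1.
pose E := Num.sqrt (expR (T * (c + 1)) * psi x ^+ 2).
exists E => [|n xn]; first exact: sqrtr_ge0.
pose Q := \sum_(y <- box C n) psi y ^+ 2 * (2 * \sum_(z <- box C n.+1) edge_weight y z) ^+ 2.
have Q0 : 0 <= Q by apply: sumr_ge0 => y _; rewrite mulr_ge0// sqr_ge0.
exists (1 + Q) => [|dt j dt0 dtq dtT y]; first by rewrite ltr_pwDl.
have dtQ : dt * Q <= 1 by apply: le_trans dtq; rewrite ler_wpM2l// lerDr.
have := @iter_euler_bound R C (box C n) (box C n.+1) edge_weight (box_uniq C n)
  (box_uniq C n.+1) (box_sub (leqnSn n)) W0 WC psi c (psi1 n) (fun y _ => Hc n y)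
  dt x j y c0 dt0 dtQ xn.
rewrite -/(euler_kernel n dt x j) => H.
have psi0 : 0 <= psi y by rewrite exprn_ge0// ltW// bracket2_gt0.
rewrite -/(psi y) -(ger0_norm psi0) -normrM mulrC -sqrtr_sqr /E ler_wsqrtr//.
apply: le_trans H _; rewrite ler_wpM2r ?sqr_ge0// ler_expR.
by rewrite ler_wpM2r// addr_ge0.
Qed.

Lemma kernel_bounds N T (x : C) : exists2 E : R, 0 <= E &
  forall n, x \in box C n -> exists2 q : R, 0 < q &
    forall (dt : R) j, 0 <= dt -> dt * q <= 1 -> dt * j%:R <= T ->
    (forall y, `|euler_kernel n dt x j y| <= E) /\
    forall K (u : C -> R), (forall z : C, `|u z| <= K * bracket2 R (val z) ^+ N) ->
      `|box_outflow n (euler_kernel n dt x j) u| <= K * E / n.+1%:R.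
Proof.
(* Use of the N + d + 2 powers of <y>^2: N absorb the growth of [u], one the degree, d make the sum
   over the box bounded, and the last one is of order n + 1 at sites next to the boundary, which
   yields the decay of the outflow. *)
have [E E0 HE] := kernel_weighted_bound (N + d.+2)%N T x.
have [c c0 Hc] := @growth_degree R d C w cw gw.
have [_ _ wnn] := cw.
exists (E + 4 ^+ N.+1 * 8 ^+ d * c * E).
  by rewrite addr_ge0// !mulr_ge0// exprn_ge0.
move=> n xn; have [q q0 Hq] := HE n xn; exists q => // dt j dt0 dtq dtT.
have {}Hq := Hq _ _ dt0 dtq dtT; split=> [y|K u uK].
  apply: (@le_trans _ _ E); last by rewrite lerDl !mulr_ge0// exprn_ge0.
  by apply: le_trans (Hq y); rewrite ler_peMr// exprn_ege1// bracket2_ge1.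
have K0 : 0 <= K.
  by have := le_trans (normr_ge0 _) (uK x); rewrite pmulr_lge0// exprn_gt0// bracket2_gt0.
set a := euler_kernel _ _ _ _ in Hq *.
pose V (y : C) := bracket2 R (val y).
have V0 y : 0 < V y by exact: bracket2_gt0.
apply: (@le_trans _ _ (K * E * 4 ^+ N.+1 / n.+1%:R *
   \sum_(y <- box C n) \sum_(z <- box C n.+1) edge_weight y z * (V y ^+ d.+1)^-1)).
  rewrite mulr_sumr; apply: le_trans (ler_norm_sum _ _ _) _.
  rewrite big_seq [leRHS]big_seq; apply: ler_sum => y yn.
  apply: le_trans (ler_norm_sum _ _ _) _.
  rewrite mulr_sumr [leRHS](bigID [pred z | z \notin box C n]) /= -[leLHS]addr0 lerD//; last first.
    apply: sumr_ge0 => z _; apply: mulr_ge0; last first.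
      by rewrite mulr_ge0// invr_ge0 exprn_ge0// ltW.
    by rewrite divr_ge0// !mulr_ge0// exprn_ge0.
  apply: ler_sum => z zn; rewrite !normrM (ger0_norm (W0 _ _)).
  have [yz|/wnn wyz] := boolP (nn (val y) (val z)); last first.
    by rewrite /edge_weight wyz !(mulr0,mul0r).
  have Vz : V z <= 4 * V y by exact: nn_bracket2_le.
  have Vy : n.+1%:R <= 4 * V y.
    apply: le_trans Vz; apply: le_trans (zbox_bracket2 _ (_ : val z \notin zbox d n)).
      rewrite expr2; have : 1 <= n.+1%:R :> R by rewrite ler1n.
      by nra.
    by rewrite -mem_box.
  have H1 : `|a y| <= E / V y ^+ (N + d.+2) by rewrite ler_pdivlMr ?exprn_gt0.
  have H2 : `|u z| <= K * (4 * V y) ^+ N.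
    apply: le_trans (uK z) _; rewrite ler_wpM2l// lerXn2r ?nnegrE//.
      exact/ltW/V0.
    by rewrite mulr_ge0// ltW.
  apply: (@le_trans _ _ (E / V y ^+ (N + d.+2) * edge_weight y z * (K * (4 * V y) ^+ N))).
    by apply: ler_pM => //; rewrite ?mulr_ge0// ler_wpM2r.
  rewrite exprMn !exprD ![_ ^+ _.+1]exprS.
  have k0 : 0 < n.+1%:R :> R by rewrite ltr0n.
  move: (n.+1%:R : R) Vy k0 => k Vy k0.
  have Vd : V y ^+ d != 0 by rewrite expf_neq0// gt_eqF.
  have VN : V y ^+ N != 0 by rewrite expf_neq0// gt_eqF.
  have Vn0 : V y != 0 by rewrite gt_eqF.
  have kn0 : k != 0 by rewrite gt_eqF.
  have -> : E / (V y ^+ N * (V y * (V y * V y ^+ d))) * edge_weight y z * (K * (4 ^+ N * V y ^+ N)) =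
    (K * E * 4 ^+ N * edge_weight y z / (V y * V y ^+ d)) * (V y)^-1.
    by field; rewrite Vn0 Vd VN.
  have -> : K * E * (4 * 4 ^+ N) / k * (edge_weight y z / (V y * V y ^+ d)) =
    (K * E * 4 ^+ N * edge_weight y z / (V y * V y ^+ d)) * (4 / k).
    by field; rewrite kn0 Vn0 Vd.
  apply: ler_wpM2l.
    by rewrite divr_ge0 ?mulr_ge0 ?exprn_ge0// ?ltW.
  by rewrite ler_pdivlMr// mulrC ler_pdivrMr.
have S8 : \sum_(y <- box C n) \sum_(z <- box C n.+1) edge_weight y z * (V y ^+ d.+1)^-1 <=
    c * 8 ^+ d.
  apply: le_trans (ler_wpM2l c0 (sum_box_bracket2 R C n)).
  rewrite mulr_sumr; apply: ler_sum => y _.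
  rewrite -mulr_suml ler_pdivrMr ?exprn_gt0// exprS.
  have -> : c / bracket2 R (val y) ^+ d * (V y * V y ^+ d) = c * V y.
    by rewrite -/(V y); field; rewrite expf_neq0// gt_eqF.
  by rewrite Hc ?box_uniq.
apply: le_trans (ler_wpM2l _ S8) _.
  by rewrite divr_ge0// !mulr_ge0// exprn_ge0.
rewrite mulrAC ler_wpM2r ?invr_ge0//.
have -> : K * E * 4 ^+ N.+1 * (c * 8 ^+ d) = K * (4 ^+ N.+1 * 8 ^+ d * c * E) by ring.
by rewrite ler_wpM2l// lerDr.
Qed.

End kernel.

(** * Gaussian cosine integrals *)

Section trigo.
Variable R : realType.
Implicit Types x v : R.

Lemma cos1_le_cos x : `|x| <= 1 -> cos 1 <= cos x.
Proof.
move=> x1; have pi2 := pi_ge2 R; have x0 := normr_ge0 x.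
have h1 : `|x| \in `[0, pi] by rewrite in_itv /= x0 (le_trans x1)//; lra.
have h2 : 1 \in `[0, @pi R] by rewrite in_itv /= ler01; lra.
by rewrite -(cos_norm x) leNgt ltr_cos// -leNgt.
Qed.

Lemma cos1_mul_le_sin x : 0 <= x <= 1 -> cos 1 * x <= sin x.
Proof.
move=> /andP[x0 x1].
have [|c] := @MVT_segment R sin cos 0 x x0 (fun y _ => is_derive_sin y).
  exact/continuous_subspaceT/continuous_sin.
rewrite in_itv /= sin0 !subr0 => /andP[c0 cx] ->.
by rewrite ler_wpM2r// cos1_le_cos// ger0_norm//; lra.
Qed.

(** The difference of the two sides has derivative sin y - cos 1 * y, which is nonnegative on
    [0, 1]; apply the mean value theorem after reducing to [|v|]. *)
Lemma sqr_le_1Bcos v : `|v| <= 1 -> cos 1 * v ^+ 2 / 2 <= 1 - cos v.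
Proof.
rewrite -(cos_norm v) -[v ^+ 2]real_normK ?num_real//.
have : 0 <= `|v| by []. move: `|v| => {}v v0 v1.
pose f (x : R) : R := - cos x - cos 1 / 2 * x ^+ 2.
have df (y : R) : is_derive y 1 f (sin y - cos 1 * y).
  rewrite /f; apply: is_derive_eq.
  by rewrite /GRing.scale /=; field.
have [|c] := @MVT_segment R f (fun y => sin y - cos 1 * y) 0 v v0 (fun y _ => df y).
  apply: continuous_subspaceT => y; apply: differentiable_continuous.
  by apply/derivable1_diffP; have [] := df y.
rewrite in_itv /= => /andP[c0 cv].
have := @cos1_mul_le_sin c; rewrite c0 (le_trans cv v1) => /(_ isT) H.
rewrite /f cos0 expr0n mulr0 !subr0 => E.
have : 0 <= (sin c - cos 1 * c) * v by rewrite mulr_ge0// subr_ge0.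
by rewrite -E; lra.
Qed.

End trigo.

Section Rintegral_bound.
Import HBNNSimple.

(** Stated without measurability of [g]: it will be applied to the semigroup as a function of the
    initial state, and nothing is assumed about the measurability of the solution in [phi0]. The
    integral of a nonnegative function is a supremum over simple functions below it, so the bound
    survives. *)
Lemma Rintegral_le_cst (R : realType) (d : measure_display) (T : measurableType d)
    (mu : probability T R) (g : T -> R) (c : R) :
  (forall x, `|g x| <= c) -> `|\int[mu]_x g x| <= c.
Proof.
move=> gc; have c0 : 0 <= c by apply: le_trans (gc point).
have nn (h : T -> \bar R) : (forall x, (0 <= h x <= c%:E)%E) -> exists2 r : R, 0 <= r <= c &
    (\int[mu]_x h x)%E = r%:E.
  move=> hc; have h0 : (0 <= \int[mu]_x h x)%E.
    by apply: integral_ge0 => x _; have /andP[] := hc x.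
  have : (\int[mu]_x h x <= c%:E)%E.
    rewrite ge0_integralTE; last by move=> x; have /andP[] := hc x.
    apply/ge_ereal_sup => _ /= [f fh <-].
    pose cc : {nonneg R} := NngNum c0.
    have -> : c%:E = sintegral mu (cst_nnsfun T cc).
      transitivity (sintegral mu (cst cc%:num \_ setT)).
        rewrite (sintegral_EFin_cst mu setT cc) /=.
        by rewrite -[X in (_ * X)%E]/(mu setT) probability_setT mule1.
      by congr (sintegral mu _); apply/funext => x; rewrite patchE in_setT.
    apply: le_sintegral => x; rewrite /= -lee_fin.
    by apply: le_trans (fh x) _; have /andP[] := hc x.
  by move: h0; case: (\int[mu]_x h x)%E => // r; rewrite !lee_fin => r0 rc; exists r => //; rewrite r0.
rewrite /Rintegral integralE.
have gcx x : (- c <= g x) /\ (g x <= c).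
  by have := gc x; rewrite ler_norml => /andP[].
have [|r1 /andP[r10 r1c] ->] := nn (fun x => (EFin \o g)^\+%E x).
  move=> x; rewrite funepos_ge0 funeposE /= ge_max !lee_fin c0 andbT.
  by have [] := gcx x.
have [|r2 /andP[r20 r2c] ->] := nn (fun x => (EFin \o g)^\-%E x).
  move=> x; rewrite funeneg_ge0 funenegE /= ge_max !lee_fin c0 andbT.
  by have [] := gcx x; lra.
by rewrite /= ler_norml; apply/andP; split; lra.
Qed.

End Rintegral_bound.

Section bounded_functions.
Context d (T : measurableType d) (R : realType) (P : probability T R).
Implicit Types f g : T -> R.

Lemma bounded_integrable M f : measurable_fun setT f -> (forall x, `|f x| <= M) ->
  P.-integrable setT (EFin \o f).
Proof.
move=> mf fM; apply: measurable_bounded_integrable => //.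
  by rewrite -[(_ < _)%E]/(P setT < +oo)%E probability_setT ltry.
exists M; split; first exact: num_real.
by move=> x Mx y _ /=; exact: le_trans (fM y) (ltW Mx).
Qed.

Lemma Rintegral_cst_prob (r : R) : \int[P]_x r = r.
Proof.
rewrite Rintegral_cst//; transitivity (r * fine (P setT)) => //.
by rewrite probability_setT mulr1.
Qed.

Lemma Rintegral_indic_prob (A : set T) : measurable A ->
  \int[P]_x (\1_A x) = fine (P A).
Proof. by move=> mA; rewrite /Rintegral integral_indic// setIT. Qed.

Lemma measurable_cos_comp f : measurable_fun setT f -> measurable_fun setT (fun x => cos (f x)).
Proof.
move=> mf; apply: measurableT_comp mf.
by apply: continuous_measurable_fun; exact: continuous_cos.
Qed.

Lemma measurable_sin_comp f : measurable_fun setT f -> measurable_fun setT (fun x => sin (f x)).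
Proof.
move=> mf; apply: measurableT_comp mf.
by apply: continuous_measurable_fun; exact: continuous_sin.
Qed.

Lemma cos_integrable f : measurable_fun setT f ->
  P.-integrable setT (EFin \o (fun x => cos (f x))).
Proof.
by move=> mf; apply: (@bounded_integrable 1) => [|x]; [exact: measurable_cos_comp|exact: cos_max].
Qed.

Lemma sin_integrable f : measurable_fun setT f ->
  P.-integrable setT (EFin \o (fun x => sin (f x))).
Proof.
by move=> mf; apply: (@bounded_integrable 1) => [|x]; [exact: measurable_sin_comp|exact: sin_max].
Qed.

End bounded_functions.

Section normal.
Variable R : realType.
Local Notation mu := (@lebesgue_measure R).

(** By scaling: the interval has length s/2 and the density there is at least exp(-1/2) times the
    peak, which is proportional to 1/s. *)
Lemma normal_prob_mass : exists2 k : R, 0 < k &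
  forall s : R, 0 < s -> (k%:E <= normal_prob 0%R s `[(s / 2)%R, s]%classic)%E.
Proof.
exists (expR (- 1 / 2) / Num.sqrt (pi *+ 2) / 2).
  by rewrite !divr_gt0// ?expR_gt0// sqrtr_gt0 pmulrn_rgt0// pi_gt0.
move=> s s0; rewrite /normal_prob.
apply: (@le_trans _ _ (\int[mu]_(x in `[(s / 2)%R, s]) (expR (- 1 / 2) * normal_peak s)%:E)%E).
  rewrite integral_cst//= lebesgue_measure_itv /= lte_fin.
  rewrite ltr_pdivrMr// ltr_pMr// ltr1n -EFinD -EFinM lee_fin.
  rewrite /normal_peak -mulrnAr sqrtrM ?sqr_ge0// sqrtr_sqr gtr0_norm//.
  have q0 : 0 < Num.sqrt (@pi R *+ 2) by rewrite sqrtr_gt0 pmulrn_rgt0// pi_gt0.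
  rewrite le_eqVlt; apply/orP; left; apply/eqP; move: (Num.sqrt _) q0 => q q0; field.
  by rewrite !gt_eqF.
apply: ge0_le_integral => //.
- by move=> x _; rewrite lee_fin mulr_ge0 ?expR_ge0// normal_peak_ge0.
- by apply/measurable_EFinP; apply: measurable_funTS; exact: measurable_normal_pdf.
move=> x; rewrite /= in_itv /= => /andP[sx xs].
rewrite lee_fin normal_pdfE ?gt_eqF// mulrC ler_wpM2l ?normal_peak_ge0//.
rewrite /normal_fun ler_expR subr0 ler_pdivlMr ?pmulrn_rgt0 ?exprn_gt0//.
have x0 : 0 <= x by lra.
have : x ^+ 2 <= s ^+ 2 by rewrite lerXn2r ?nnegrE// ltW.
by rewrite -mulr_natr; lra.
Qed.

Lemma normal_prob_sym (s : R) (A : set R) : s != 0 -> measurable A ->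
  pushforward (normal_prob 0 s) (-%R : _ -> measurableTypeR R) A = normal_prob 0 s A.
Proof.
move=> s0 mA; rewrite /pushforward /normal_prob.
transitivity (\int[pushforward mu (-%R : _ -> measurableTypeR R)]_(x in A) (normal_pdf 0 s x)%:E)%E.
  rewrite ge0_integral_pushforward//=.
  - apply: eq_integral => x _ /=; rewrite !normal_pdfE//.
    by rewrite /normal_fun !subr0 sqrrN.
  - by apply/measurable_EFinP; apply: measurable_funTS; exact: measurable_normal_pdf.
  - by move=> x _; rewrite lee_fin normal_pdf_ge0.
by apply: eq_measure_integral => //= B mB _; exact: lebesgue_measureN.
Qed.

Lemma normal_sin (s u : R) : s != 0 -> \int[normal_prob 0 s]_x sin (u * x) = 0.
Proof.
move=> s0; set P := normal_prob 0 s.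
have mu_ : measurable_fun setT (fun x : R => u * x) by apply: measurable_funM.
have intS := sin_integrable P mu_.
have : \int[P]_x sin (u * x) = \int[P]_x (-1 * sin (u * x)).
  rewrite /Rintegral; congr fine.
  transitivity (\int[pushforward P (-%R : _ -> measurableTypeR R)]_x (sin (u * x))%:E)%E.
    by apply: eq_measure_integral => //= B mB _; exact/esym/normal_prob_sym.
  rewrite integral_pushforward//=.
  - by apply: eq_integral => x _ /=; rewrite mulrN sinN mulN1r.
  - by apply/measurable_EFinP; exact: measurable_sin_comp.
  - have mu_N : measurable_fun setT (fun x : R => u * - x) by apply: measurable_funM.
    exact: (sin_integrable P mu_N).
by rewrite RintegralZl//; lra.
Qed.

(** A quadratic bound replaces the exact Gaussian characteristic function. On [s/2, s] the argument
    [u * x] is at most 1 in absolute value and at least |u| s / 2, and this interval has mass at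
    least [m] whatever [s] is. *)
Lemma normal_cos : exists2 k : R, 0 < k &
  forall s u : R, 0 < s -> `|u| * s <= 1 ->
  `|\int[normal_prob 0 s]_x cos (u * x)| <= 1 - k * (u * s) ^+ 2.
Proof.
have [m m0 Hm] := normal_prob_mass.
have c0 := cos1_gt0 R; have c1 := cos_le1 (1 : R).
exists (cos 1 * m / 8) => [|s u s0 us]; first by rewrite divr_gt0// mulr_gt0.
set P := normal_prob 0 s; set A := `[s / 2, s]%classic.
have mu_ : measurable_fun setT (fun x : R => u * x) by apply: measurable_funM.
have mA : measurable A by exact: measurable_itv.
have mP : m <= fine (P A).
  by rewrite -lee_fin fineK ?fin_num_measure//; exact: Hm.
have usq : (u * s) ^+ 2 <= 1.
  by rewrite -[leLHS]real_normK ?num_real// exprn_ile1// normrM (gtr0_norm s0).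
have us0 := sqr_ge0 (u * s).
have ux x : A x -> `|u * x| <= 1.
  rewrite /A /= in_itv /= => /andP[sx xs]; rewrite normrM (ger0_norm (_ : 0 <= x)); last by lra.
  by apply: le_trans us; rewrite ler_wpM2l.
have key (f : R -> R) a : 0 <= a -> a <= 1 -> measurable_fun setT f -> (forall x, 0 <= f x <= 2) ->
    (forall x, A x -> a <= f x) -> a * m <= \int[P]_x f x.
  move=> a0 a1 mf f0 fa.
  apply: (@le_trans _ _ (\int[P]_x (a * \1_A x))).
    rewrite RintegralZl//; last first.
      apply: (@bounded_integrable _ _ _ _ 1) => [|x]; first exact: measurable_indic.
      by rewrite indicE; case: (_ \in _); rewrite ?normr1 ?normr0.
    by rewrite Rintegral_indic_prob// ler_wpM2l.
  apply: le_Rintegral => //.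
  - apply: (@bounded_integrable _ _ _ _ a) => [|x].
      by apply: measurable_funM => //; exact: measurable_indic.
    by rewrite indicE; case: (_ \in _); rewrite ?(mulr0,mulr1,normr0)// ger0_norm.
  - apply: (@bounded_integrable _ _ _ _ 2) => // x.
    by have /andP[? ?] := f0 x; rewrite ger0_norm.
  - move=> x _; rewrite indicE; case: (boolP (x \in A)) => xA.
      by rewrite mulr1 fa//; exact: set_mem.
    by rewrite mulr0; have /andP[] := f0 x.
have ci := cos_integrable P mu_.
have mc := measurable_cos_comp mu_.
have oi : P.-integrable setT (EFin \o (fun _ : R => 1 : R)).
  by apply: (@bounded_integrable _ _ _ _ 1) => // x; rewrite normr1.
have Hup : cos 1 * (u * s) ^+ 2 / 8 * m <= 1 - \int[P]_x cos (u * x).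
  rewrite -[X in X - _](Rintegral_cst_prob P 1) -RintegralB//.
  apply: key.
  - by rewrite divr_ge0// mulr_ge0// ltW.
  - by have := @ler_pM _ (cos 1) 1 ((u * s) ^+ 2) 1 (ltW c0) us0 c1 usq; lra.
  - exact: measurable_funB.
  - by move=> x; have := cos_le1 (u * x); have := cos_geN1 (u * x); lra.
  move=> x Ax; apply: le_trans (sqr_le_1Bcos (ux x Ax)).
  move: Ax; rewrite /A /= in_itv /= => /andP[sx xs].
  have : s ^+ 2 <= 4 * x ^+ 2.
    by have -> : 4 * x ^+ 2 = (2 * x) ^+ 2 by [ring]; rewrite lerXn2r ?nnegrE; lra.
  move=> sx2; have := ler_wpM2l (mulr_ge0 (ltW c0) (sqr_ge0 u)) sx2.
  by rewrite !exprMn; lra.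
(* The absolute value also needs the integral to stay away from -1: on the same interval the cosine
   is positive. *)
have Hlo : 1 * m <= 1 + \int[P]_x cos (u * x).
  rewrite -[X in X + _](Rintegral_cst_prob P 1) -RintegralD//.
  apply: key => //.
  - exact: measurable_funD.
  - by move=> x; have := cos_le1 (u * x); have := cos_geN1 (u * x); lra.
  - move=> x Ax; have := cos1_le_cos (ux x Ax); lra.
move: Hup Hlo; move: (\int[P]_x cos (u * x)) => J Hup Hlo.
have : cos 1 * m / 8 * (u * s) ^+ 2 <= m.
  have := @ler_pM _ (cos 1) 1 ((u * s) ^+ 2) 1 (ltW c0) us0 c1 usq; nra.
by clear - Hup Hlo => H; rewrite ler_norml; apply/andP; split; lra.
Qed.

End normal.

(** * Sums of Brownian increments *)

Section independence.
Context d (Om : measurableType d) (R : realType) (P : probability Om R).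
Variable m : probability (measurableTypeR R) R.

(** The joint law is a product measure because it is one on rectangles. The addition formula then
    splits the cosine, and the sine part integrates to 0, so no complex exponential appears. *)
Lemma Rintegral_cos_indep (Y X : Om -> R) (u : R) :
  measurable_fun setT Y -> measurable_fun setT X ->
  (forall A B : set R, measurable A -> measurable B ->
    P (Y @^-1` A `&` X @^-1` B) = (P (Y @^-1` A) * m B)%E) ->
  \int[m]_x sin (u * x) = 0 ->
  \int[P]_om cos (Y om + u * X om) = \int[P]_om cos (Y om) * \int[m]_x cos (u * x).
Proof.
move=> mY mX YX sin0.
pose YT : Om -> measurableTypeR R := Y; pose XT : Om -> measurableTypeR R := X.
have mYT : measurable_fun setT YT by [].
have mXT : measurable_fun setT XT by [].
have mYX := measurable_fun_pair mYT mXT.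
pose Yf := mfun_Sub (mem_set mYT).
pose YXf := mfun_Sub (mem_set mYX).
pose mY' : probability (measurableTypeR R) R := distribution P Yf.
pose g (z : measurableTypeR R * measurableTypeR R) : R := cos (z.1 + u * z.2).
have mg : measurable_fun setT g.
  apply: measurable_cos_comp; apply: measurable_funD; first exact: measurable_fst.
  by apply: measurable_funM => //; exact: measurable_snd.
have mux : measurable_fun setT (fun x : R => u * x) by apply: measurable_funM.
have E1 : (\int[P]_om (cos (Y om + u * X om))%:E =
    \int[product_measure1 mY' m]_z (g z)%:E)%E.
  transitivity (\int[distribution P YXf]_z (g z)%:E)%E.
    rewrite integral_distribution//=; first exact/measurable_EFinP.
    apply: (@cos_integrable _ _ _ P (fun om => Y om + u * X om)).
    by apply: measurable_funD => //; apply: measurable_funM.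
  apply: eq_measure_integral => B mB _ /=.
  apply/esym; apply: (@product_measure_unique _ _ _ _ R mY' m (distribution P YXf)) => //.
rewrite /Rintegral E1 -integral12_prod_meas1; last first.
  apply: (@cos_integrable _ _ _ (product_measure1 mY' m) (fun z => z.1 + u * z.2)).
  apply: measurable_funD; first exact: measurable_fst.
  by apply: measurable_funM => //; exact: measurable_snd.
pose c := \int[m]_x cos (u * x).
have E2 y : (\int[m]_x (g (y, x))%:E = (cos y * c)%:E)%E.
  have ic := cos_integrable m mux. have is_ := sin_integrable m mux.
  transitivity (\int[m]_x (cos (y + u * x)))%:E.
    rewrite fineK//; apply: integrable_fin_num => //.
    by apply: (@cos_integrable _ _ _ m (fun x => y + u * x)); apply: measurable_funD.
  congr EFin; under eq_Rintegral do rewrite cosD.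
  rewrite RintegralB//.
  - by rewrite !RintegralZl// sin0 mulr0 subr0.
  - exact: (integrableZl measurableT (cos y) ic).
  - exact: (integrableZl measurableT (sin y) is_).
transitivity (\int[mY']_y (cos y * c)).
  by rewrite /Rintegral; congr fine; apply: eq_integral => y _; exact: E2.
rewrite RintegralZr//; last by apply: (@cos_integrable _ _ _ mY' id).
congr (_ * _); rewrite /Rintegral integral_distribution//.
  by apply/measurable_EFinP; exact: (@measurable_cos_comp _ _ _ id).
exact: cos_integrable.
Qed.

End independence.

Section brownian.
Context (R : realType) (dO : measure_display) (Om : measurableType dO).
Variables (P : probability Om R) (Fil : R -> set (set Om)) (I : choiceType).
Variable B : I -> R -> Om -> R.
Hypotheses (filF : filtration Fil) (bmB : independent_brownian_motions P Fil B).

Definition past_measurable (s : R) (Y : Om -> R) :=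
  forall A : set R, measurable A -> Fil s (Y @^-1` A).

Lemma past_measurable_fun s Y : 0 <= s -> past_measurable s Y -> measurable_fun setT Y.
Proof.
move=> s0 mY _ A mA; rewrite setTI.
by have [_ Fm _] := filF; apply: (Fm s s0); exact: mY.
Qed.

Lemma increment_measurable x s t : 0 <= s -> s <= t ->
  past_measurable t (fun om => B x t om - B x s om).
Proof.
move=> s0 st A mA; have t0 := le_trans s0 st.
have [sF _ Finc] := filF; have [_ _ Bad _] := bmB.
have Bm r : 0 <= r -> r <= t -> past_measurable t (B x r).
  by move=> r0 rt E mE; apply: (Finc r t r0 rt); exact: Bad.
have sFt := sF t t0.
(* [Fil t] is only a set of sets; this gives [Om] the measurable structure it generates, which is
   [Fil t] itself, so that library closure results apply. *)
pose T' := g_sigma_algebraType (Fil t).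
have FE : Fil t = <<s Fil t>> by apply/esym/smallest_id.
have m1 : measurable_fun setT (B x t : T' -> R).
  by move=> _ E mE; rewrite setTI; apply: sub_sigma_algebra; exact: Bm.
have m2 : measurable_fun setT (B x s : T' -> R).
  by move=> _ E mE; rewrite setTI; apply: sub_sigma_algebra; exact: Bm.
have := measurable_funB m1 m2 => /(_ measurableT A mA).
by rewrite setTI => H; rewrite FE; exact: H.
Qed.

Section one_step.
Variables (s t : R).
Hypotheses (s0 : 0 <= s) (st : s < t).
Let N := normal_prob 0 (Num.sqrt (t - s)).
Let dB x om := B x t om - B x s om.

Let mdB x : measurable_fun setT (dB x).
Proof.
by apply: (@past_measurable_fun t); [exact: le_trans s0 (ltW st)|exact: increment_measurable (ltW st)].
Qed.

(** A pi-system generating the sigma-algebra of the past up to [s] together with the increments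
    indexed by [xs]. *)
Let joint (xs : seq I) : set (set Om) :=
  [set S | exists A, exists E : I -> set R, [/\ Fil s A, (forall x, measurable (E x)) &
    S = A `&` [set om | forall x, x \in xs -> E x (dB x om)]]].

Lemma joint_setI xs : setI_closed (joint xs).
Proof.
have [sF _ _] := filF; have sFs := sF s s0.
move=> _ _ [A [E [FA mE ->]]] [A' [E' [FA' mE' ->]]].
exists (A `&` A'), (fun x => E x `&` E' x); split.
- rewrite -(smallest_id sFs); apply: (@measurableI _ (g_sigma_algebraType (Fil s)));
  exact: sub_sigma_algebra.
- by move=> x; exact: measurableI.
apply/seteqP; split => om /=.
  by move=> [[? H] [? H']]; split => // x xxs; split; [exact: H|exact: H'].
by move=> [[? ?] H]; do 2 split => //; move=> x xxs; have [] := H x xxs.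
Qed.

Lemma FilT : Fil s setT.
Proof.
have [sF _ _] := filF; have [F0 FC _] := sF s s0.
by rewrite -(setD0 setT); exact: FC.
Qed.

Lemma joint_measurable xs : joint xs `<=` measurable.
Proof.
have [_ Fm _] := filF.
move=> _ [A [E [FA mE ->]]]; apply: measurableI; first exact: Fm FA.
rewrite (_ : [set om | _] = \big[setI/setT]_(x <- xs) (dB x @^-1` E x)).
  apply: bigsetI_measurable => x _; rewrite -(setTI (_ @^-1` _)); exact: mdB.
elim: xs => [|x xs IH].
  by rewrite big_nil; apply/seteqP; split.
rewrite big_cons -IH; apply/seteqP; split => om /=.
  move=> H; split; first by apply: H; rewrite mem_head.
  by move=> y yxs; apply: H; rewrite inE yxs orbT.
by move=> [H1 H2] y; rewrite inE => /orP[/eqP->//|]; exact: H2.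
Qed.

(** Independence is given on the pi-system only. Both sides are finite measures in [S] agreeing
    there, hence on the generated sigma-algebra. *)
Lemma increment_indep xs x0 (S : set Om) (E0 : set R) :
  uniq (x0 :: xs) -> measurable E0 -> <<s joint xs >> S ->
  P (S `&` dB x0 @^-1` E0) = (P S * N E0)%E.
Proof.
move=> uxs mE0 JS; have [_ _ _ Bind] := bmB.
have mX : measurable (dB x0 @^-1` E0) by rewrite -(setTI (_ @^-1` _)); exact: mdB.
have n0 : 0 <= fine (N E0) by rewrite fine_ge0.
pose r : {nonneg R} := NngNum n0.
have rE : (r%:num)%:E = N E0 by rewrite /= fineK// fin_num_measure.
pose m1 : {measure set Om -> \bar R} := mrestr P mX.
pose m2 : {measure set Om -> \bar R} := mscale r P.
rewrite -rE muleC.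
apply: (g_sigma_algebra_measure_unique (joint xs) _ (fun _ => setT) _ _ m1 m2) => //.
- exact: joint_measurable.
- move=> _; exists setT, (fun _ => setT); split => //; first exact: FilT.
  by apply/seteqP; split.
- by rewrite bigcup_const//; exists 0%N.
- exact: joint_setI.
- move=> _ [A [E [FA mE ->]]].
  rewrite /m1 /m2 /= /mrestr /mscale rE.
  have uxs' : uniq xs by move: uxs => /= /andP[].
  (* The independence hypothesis is used twice, for [x0 :: xs] with [E0] at [x0], and for [xs]
     alone. *)
  pose E' x := if x == x0 then E0 else E x.
  have mE' x : measurable (E' x) by rewrite /E'; case: ifP.
  have := Bind s t A (x0 :: xs) E' s0 st FA uxs mE'.
  have E'0 : E' x0 = E0 by rewrite /E' eqxx.
  rewrite big_cons E'0.
  rewrite (_ : \prod_(x <- xs) _ = \prod_(x <- xs) N (E x))%E; last first.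
    rewrite big_seq [RHS]big_seq; apply: eq_bigr => x xxs; rewrite /E'.
    by case: eqP => // xx0; move: uxs => /= /andP[]; rewrite -xx0 xxs.
  rewrite muleCA -(Bind s t A xs E s0 st FA uxs' mE) => <-.
  congr (P _); apply/seteqP; split => om /=.
    move=> [[Aom H] H0]; split => // x; rewrite inE /E'.
    by case: eqP => [->//|_] /= /H.
  move=> [Aom H]; split; last by have := H x0; rewrite mem_head /E' eqxx => /(_ isT).
  split => // x xxs; have := H x; rewrite inE xxs orbT /E' => /(_ isT).
  by case: eqP => // xx0; move: uxs => /= /andP[]; rewrite -xx0 xxs.
- by move=> k; rewrite /m1 /= /mrestr (le_lt_trans (probability_le1 _ _))// ?ltry// setTI.
Qed.

(** The sites are peeled off one by one: [Y] plus the sum over the remaining sites is measurable for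
    the sigma-algebra of [joint xs], hence independent of the increment at [x0]. *)
Lemma cos_increments Y (a : I -> R) xs : uniq xs -> past_measurable s Y ->
  \int[P]_om cos (Y om + \sum_(x <- xs) a x * dB x om) =
  \int[P]_om cos (Y om) * \prod_(x <- xs) \int[N]_z cos (a x * z).
Proof.
move=> uxs mY; elim: xs uxs => [_|x0 xs IH uxs].
  by under eq_Rintegral do rewrite big_nil addr0; rewrite big_nil mulr1.
rewrite big_cons mulrCA mulrC -IH; last by move: uxs => /= /andP[].
under eq_Rintegral do rewrite big_cons [a x0 * _ + _]addrC addrA.
have mY' := past_measurable_fun s0 mY.
have mS : measurable_fun setT (fun om => Y om + \sum_(x <- xs) a x * dB x om).
  by apply: measurable_funD => //; apply: measurable_sum => x; exact: measurable_funM.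
apply: Rintegral_cos_indep => //.
- move=> A E mA mE; apply: (@increment_indep xs) => //.
  pose T' := g_sigma_algebraType (joint xs).
  have mYT : measurable_fun setT (Y : T' -> R).
    move=> _ D mD; rewrite setTI; apply: sub_sigma_algebra.
    exists (Y @^-1` D), (fun=> setT); split => //; first exact: mY.
    by apply/seteqP; split => om //= -[].
  have mdBT x : x \in xs -> measurable_fun setT (dB x : T' -> R).
    move=> xxs _ D mD; rewrite setTI; apply: sub_sigma_algebra.
    exists setT, (fun y => if y == x then D else setT); split.
    - exact: FilT.
    - by move=> y; case: ifP.
    apply/seteqP; split => om /=.
      by move=> Dx; split => // y _; case: eqP => [->|].
    by move=> [_ /(_ x xxs)]; rewrite eqxx.
  have mST : measurable_fun setT (fun om : T' => Y om + \sum_(x <- xs) a x * dB x om).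
    apply: measurable_funD => //.
    (* [measurable_sum] asks for every index, while measurability is known only for indices in [xs];
       the conditional makes the other summands constant. *)
    rewrite (_ : (fun om => _) = (fun om : T' => \sum_(x <- xs) (if x \in xs then fun om => a x * dB x om else cst 0) om)).
      apply: measurable_sum => x; case: ifP => // xxs.
      exact: (measurable_funM (measurable_cst (a x)) (mdBT x xxs)).
    apply/funext => om; rewrite big_seq [RHS]big_seq.
    by apply: eq_bigr => x xxs; rewrite xxs.
  by have := mST measurableT A mA; rewrite setTI => H; exact: H.
- by apply: normal_sin; rewrite gt_eqF// sqrtr_gt0 subr_gt0.
Qed.

End one_step.

Lemma past_measurableP t Y : 0 <= t ->
  past_measurable t Y <-> measurable_fun setT (Y : g_sigma_algebraType (Fil t) -> R).
Proof.
move=> t0; have [sF _ _] := filF; have FE : Fil t = <<s Fil t>> by apply/esym/smallest_id/sF.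
split => [mY _ A mA|mY A mA]; first by rewrite setTI; apply: sub_sigma_algebra; exact: mY.
by have := mY measurableT A mA; rewrite setTI => H; rewrite FE; exact: H.
Qed.

Lemma past_measurable_le s t Y : 0 <= s -> s <= t -> past_measurable s Y -> past_measurable t Y.
Proof.
by move=> s0 st mY A mA; have [_ _ Finc] := filF; apply: (Finc s t s0 st); exact: mY.
Qed.

Definition brownian_sum (h : R) (a : nat -> I -> R) (xs : seq I) m om :=
  \sum_(k < m) \sum_(x <- xs) a k x * (B x (h * k.+1%:R) om - B x (h * k%:R) om).

Lemma past_measurable_brownian_sum c h a xs m : 0 <= h ->
  past_measurable (h * m%:R) (fun om => c + brownian_sum h a xs m om).
Proof.
move=> h0; apply/past_measurableP; first by rewrite mulr_ge0.
apply: measurable_funD => //; rewrite /brownian_sum.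
under eq_fun do rewrite -(big_mkord xpredT (fun k => \sum_(x <- xs) a k x * (B x (h * k.+1%:R) _ - B x (h * k%:R) _))) big_nat.
rewrite (_ : (fun om => _) = (fun om : g_sigma_algebraType (Fil (h * m%:R)) =>
  \sum_(0 <= k < m) (if (k < m)%N then fun om =>
    \sum_(x <- xs) a k x * (B x (h * k.+1%:R) om - B x (h * k%:R) om) else cst 0) om)); last first.
  apply/funext => om; rewrite [RHS]big_nat; apply: eq_bigr => k /andP[_ km].
  by rewrite km.
apply: measurable_sum => k; case: ifP => // km.
apply: measurable_sum => x; apply: (measurable_funM (measurable_cst (a k x))).
apply/past_measurableP; first by rewrite mulr_ge0.
apply: (@past_measurable_le (h * k.+1%:R)); first by rewrite mulr_ge0.
  by rewrite ler_wpM2l// ler_nat.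
by apply: increment_measurable; [rewrite mulr_ge0|rewrite ler_wpM2l// ler_nat].
Qed.

(** Each time step multiplies the integral by a product over the sites of factors at most 1 - k a^2
    h <= exp(- k a^2 h). The smallness condition is that of [normal_cos] for standard deviation
    [Num.sqrt h]. The constant [c] is only a phase, and [k] is universal. *)
Lemma cos_brownian_sum : exists2 k : R, 0 < k &
  forall (c h : R) a xs m, 0 < h -> uniq xs ->
  (forall k x, (k < m)%N -> x \in xs -> `|a k x| * Num.sqrt h <= 1) ->
  `|\int[P]_om cos (c + brownian_sum h a xs m om)| <=
  expR (- (k * h * \sum_(k < m) \sum_(x <- xs) a k x ^+ 2)).
Proof.
have [k k0 Hk] := normal_cos R; exists k => // c h a xs m h0 uxs.
elim: m => [_|m IH Ha].
  rewrite big_ord0 mulr0 oppr0 expR0.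
  by apply: Rintegral_le_cst => om; exact: cos_max.
have hm0 : 0 <= h * m%:R by rewrite mulr_ge0// ltW.
have hm1 : h * m%:R < h * m.+1%:R by rewrite ltr_pM2l// ltr_nat.
have -> : \int[P]_om cos (c + brownian_sum h a xs m.+1 om) =
   \int[P]_om cos ((c + brownian_sum h a xs m om) +
     \sum_(x <- xs) a m x * (B x (h * m.+1%:R) om - B x (h * m%:R) om)).
  by apply: eq_Rintegral => om _; rewrite /brownian_sum big_ord_recr /= addrA.
rewrite (cos_increments hm0 hm1)//; last by apply: past_measurable_brownian_sum; exact: ltW.
rewrite normrM big_ord_recr /= mulrDr opprD expRD ler_pM//.
  by apply: IH => j x jm; apply: Ha; exact: ltnW.
rewrite normr_prod -mulrA mulr_sumr mulr_sumr -sumrN expR_sum.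
rewrite big_seq [leRHS]big_seq; apply: ler_prod => x xxs; rewrite normr_ge0/=.
have -> : h * m.+1%:R - h * m%:R = h by rewrite -natr1; ring.
have sh : 0 < Num.sqrt h by rewrite sqrtr_gt0.
apply: le_trans (Hk _ _ sh (Ha m x (ltnSn m) xxs)) _.
rewrite exprMn (sqr_sqrtr (ltW h0)).
apply: le_trans _ (expR_ge1Dx _).
by rewrite lerD2l lerN2; rewrite le_eqVlt; apply/orP; left; apply/eqP; ring.
Qed.

End brownian.

(** * The heat kernel of the random walk *)

Section integral_increments.
Variable R : realType.
Local Notation mu := (@lebesgue_measure R).

Lemma continuous_itv_integrable (g : R -> R) (a b : R) :
  continuous g -> mu.-integrable `[a, b] (EFin \o g).
Proof.
move=> cg; apply: continuous_compact_integrable; first exact: segment_compact.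
exact: continuous_subspaceT.
Qed.

Lemma Rintegral_increment (g : R -> R) (a b c e : R) : continuous g ->
  0 <= a -> a <= b -> (forall s, a <= s <= b -> `|g s - c| <= e) ->
  `|\int[mu]_(s in `[0, b]) g s - \int[mu]_(s in `[0, a]) g s - (b - a) * c|
   <= (b - a) * e.
Proof.
move=> cg a0 ab ge.
have gi := @continuous_itv_integrable g 0 b cg.
rewrite Rintegral_itvB//.
have iab (k : R -> R) : continuous k -> mu.-integrable `]a, b] (EFin \o k).
  move=> ck; apply: integrableS (@continuous_itv_integrable k a b ck) => //.
  by apply: subset_itvr; rewrite bnd_simp.
have cstE (k : R) : \int[mu]_(s in `]a, b]) k = (b - a) * k.
  rewrite Rintegral_cst//= lebesgue_measure_itv /= lte_fin.
  have [ab'|ba] := ltP a b; first by rewrite -EFinD /= mulrC.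
  by have -> : a = b by [apply/eqP; rewrite eq_le ab ba]; rewrite subrr mulr0 mul0r.
rewrite -(cstE c) -RintegralB//; last 2 first.
- exact: iab.
- by apply: iab => x; exact: cvg_cst.
have ckg : continuous (fun s => g s - c).
  by move=> x; apply: cvgB; [exact: cg|exact: cvg_cst].
apply: le_trans (le_normr_Rintegral _ _) _ => //; first exact: iab.
rewrite -(cstE e); apply: le_Rintegral => //.
- apply: iab => x; apply: cvg_norm; exact: ckg.
- by apply: iab => x; exact: cvg_cst.
move=> s; rewrite /= in_itv /= => /andP[sa sb]; apply: ge.
by rewrite (ltW sa).
Qed.

Lemma Rintegral_le_riemann (g : R -> R) (h e : R) M : continuous g -> 0 <= h ->
  (forall s k, (k < M)%N -> h * k%:R <= s <= h * k.+1%:R -> `|g s - g (h * k%:R)| <= e) ->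
  \int[mu]_(s in `[0, h * M%:R]) g s <= \sum_(k < M) h * g (h * k%:R) + h * M%:R * e.
Proof.
move=> cg h0; elim: M => [_|M IH ge].
  by rewrite big_ord0 mulr0 set_itv1 Rintegral_set1 mul0r addr0.
have {IH} := IH (fun s k kM => ge s k (ltnW kM)).
have hM : h * M%:R <= h * M.+1%:R by rewrite ler_wpM2l// ler_nat.
have := @Rintegral_increment g (h * M%:R) (h * M.+1%:R) (g (h * M%:R)) e cg
  (mulr_ge0 h0 (ler0n _ _)) hM (fun s => ge s M (ltnSn M)).
rewrite ler_norml => /andP[_]; rewrite big_ord_recr /= -natr1; lra.
Qed.

End integral_increments.

Lemma near_all_seq (T : Type) (I : eqType) (F : set_system T) (s : seq I) (Q : I -> T -> Prop) :
  Filter F -> (forall i, i \in s -> \forall x \near F, Q i x) ->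
  \forall x \near F, forall i, i \in s -> Q i x.
Proof.
move=> FF; elim: s => [|i s IH] H; first exact: nearW.
have Hs := IH (fun j js => H j (@mem_behead _ (i :: s) j js)).
apply: filterS2 (H i (mem_head i s)) Hs => x Hi Hs j.
by rewrite inE => /orP[/eqP->//|]; exact: Hs.
Qed.

Lemma near_at_right0 (R : realFieldType) (Q : R -> Prop) :
  (\forall h \near 0^'+, Q h) -> exists2 r, 0 < r & forall h, 0 < h -> h < r -> Q h.
Proof.
move=> [r /= r0 H]; exists r => // h h0 hr; apply: H => //=.
by rewrite sub0r normrN gtr0_norm.
Qed.

Lemma near_infty_at_right0 (R : realType) (T : R) (Q : R -> Prop) : 0 < T ->
  (\forall h \near 0^'+, Q h) -> \forall M \near \oo, (0 < M)%N /\ Q (T / M%:R).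
Proof.
move=> T0 /near_at_right0[r r0 H]; near=> M.
have M0 : 0 < M%:R :> R by near: M; exact: nbhs_infty_gtr.
split; first by rewrite -(ltr0n R).
apply: H; first exact: divr_gt0.
rewrite ltr_pdivrMr// mulrC -ltr_pdivrMr//.
by near: M; exact: nbhs_infty_gtr.
Unshelve. all: by end_near. Qed.

(** * Heat kernel: increments, continuity and comparison with the killed scheme *)

Section chain.
Variables (R : realType) (d : nat) (w : Zd d -> Zd d -> R) (C : set (Zd d)).
Variables (dX : measure_display) (OmX : measurableType dX).
Variables (PX : C -> probability OmX R) (X : R -> OmX -> C).
Hypotheses (cw : conductances w) (gw : growth_assumption w).
Hypothesis vX : variable_speed_random_walk w PX X.

Local Notation W := (edge_weight w (C:=C)).

Definition heat (t : R) (x y : C) : R := fine (transition PX X t x y).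

Let mX t y : 0 <= t -> measurable (X t @^-1` [set y]).
Proof. by have [H _ _ _ _] := vX; exact: H. Qed.

Lemma heatE t x y : 0 <= t -> transition PX X t x y = (heat t x y)%:E.
Proof. by move=> t0; rewrite /heat fineK// fin_num_measure//; exact: mX. Qed.

Lemma heat_ge0 t x y : 0 <= heat t x y.
Proof. by rewrite /heat fine_ge0. Qed.

Lemma heat_le1 t x y : 0 <= t -> heat t x y <= 1.
Proof.
by move=> t0; rewrite -lee_fin -heatE//; apply: probability_le1; exact: mX.
Qed.

Lemma heat0 x y : heat 0 x y = (x == y)%:R.
Proof.
have [_ X0 _ _ _] := vX.
have [->|xy] := eqVneq x y; first by rewrite /heat /transition X0.
apply/eqP; rewrite eq_le heat_ge0 andbT -lee_fin -heatE//.
have := probability_setC (PX x) (mX x (lexx 0)); rewrite X0 subee// => H; rewrite -[leRHS]/(0%E) -H.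
apply: le_measure; rewrite ?inE; [exact: mX|apply: measurableC; exact: mX|].
by move=> om /= ->; apply/eqP; rewrite eq_sym.
Qed.

Lemma prob_split t x (E : set OmX) (s : seq C) : 0 <= t -> uniq s -> measurable E ->
  fine (PX x (E `&` [set om | X t om \in s])) =
  \sum_(y <- s) fine (PX x (E `&` X t @^-1` [set y])).
Proof.
move=> t0; have mS (r : seq C) : measurable [set om | X t om \in r].
  elim: r => [|y r IH].
    by rewrite (_ : [set _ | _] = set0)//; apply/seteqP; split.
  rewrite (_ : [set _ | _] = X t @^-1` [set y] `|` [set om | X t om \in r]).
    by apply: measurableU => //; exact: mX.
  apply/seteqP; split => om /=.
    by rewrite inE => /orP[/eqP|]; [left|right].
  by rewrite inE => -[->|->]; rewrite ?eqxx ?orbT.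
move=> + mE; elim: s => [_|y s IH /= /andP[ys us]].
  rewrite big_nil (_ : _ `&` _ = set0) ?measure0//.
  by apply/seteqP; split => om //= [].
rewrite big_cons -(IH us).
rewrite (_ : _ `&` _ = (E `&` X t @^-1` [set y]) `|` (E `&` [set om | X t om \in s])).
  have m1 : measurable (E `&` X t @^-1` [set y]) by apply: measurableI => //; exact: mX.
  have m2 : measurable (E `&` [set om | X t om \in s]) by apply: measurableI.
  rewrite measureU//.
    by rewrite fineD// fin_num_measure.
  by apply/seteqP; split => om //= [[_ ->] [_]]; rewrite (negbTE ys).
rewrite -setIUr; congr (_ `&` _); apply/seteqP; split => om /=.
  by rewrite inE => /orP[/eqP|]; [left|right].
by rewrite inE => -[->|->]; rewrite ?eqxx ?orbT.
Qed.

(** With a finite list of intermediate states, the defect is the probability of reaching [z] after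
    being outside [s] at time [h], hence at most the probability of being outside [s]. *)
Lemma chapman_kolmogorov h t x z (s : seq C) : 0 <= h -> 0 <= t -> uniq s ->
  0 <= heat (h + t) x z - \sum_(y <- s) heat h x y * heat t y z <=
  1 - \sum_(y <- s) heat h x y.
Proof.
move=> h0 t0 us; have ht0 : 0 <= h + t by rewrite addr_ge0.
set E := X (h + t) @^-1` [set z]; have mE : measurable E by exact: mX.
have -> : \sum_(y <- s) heat h x y * heat t y z =
    fine (PX x (E `&` [set om | X h om \in s])).
  rewrite prob_split//; apply: eq_bigr => y _.
  have [_ _ _ markov _] := vX.
  have pT : past X h setT.
    move=> D /= [[D0 DC _] _]; rewrite -(setD0 setT); exact: DC.
  have := markov x y z h t setT h0 t0 pT; rewrite setTI setIC => ->.
  by rewrite fineM// fin_num_measure//; exact: mX.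
have -> : \sum_(y <- s) heat h x y = fine (PX x (setT `&` [set om | X h om \in s])).
  by rewrite prob_split//; apply: eq_bigr => y _; rewrite setTI.
set S := [set om | _].
have mS : measurable S.
  rewrite (_ : S = \big[setU/set0]_(y <- s) (X h @^-1` [set y])).
    by apply: bigsetU_measurable => y _; exact: mX.
  rewrite /S; elim: s {us S} => [|y s IH]; first by rewrite big_nil; apply/seteqP; split.
  rewrite big_cons -IH; apply/seteqP; split => om /=.
    by rewrite inE => /orP[/eqP|]; [left|right].
  by rewrite inE => -[->|->]; rewrite ?eqxx ?orbT.
have P1 A : measurable A -> fine (PX x A) - fine (PX x (A `&` S)) = fine (PX x (A `\` S)).
  move=> mA; have mAS := measurableI _ _ mA mS; have mAD := measurableD mA mS.
  rewrite -[in LHS](setUIDK A S) measureU//.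
    by rewrite fineD ?fin_num_measure// setUIDK addrAC subrr add0r.
  by apply/seteqP; split => om //= [[_ +] [_]].
have -> : 1 = fine (PX x setT) by rewrite probability_setT.
rewrite /heat /transition -/E !P1// fine_ge0//= fine_le ?fin_num_measure//.
- exact: measurableD.
- exact: measurableD.
- by apply: le_measure; rewrite ?inE; [exact: measurableD|exact: measurableD|exact: setSD].
Qed.

Lemma laplacian_dirac n (u : C -> R) (y : C) : y \in box C n ->
  \sum_(v <- box C n.+1) - laplacian w (dirac_fun R v) y * u v =
  - lap (box C n.+1) W u y.
Proof.
move=> yn; have yn1 := box_sub (leqnSn n) yn.
under eq_bigr => v _ do rewrite mulNr (laplacianE cw _ yn).
rewrite sumrN; congr (- _); rewrite /lap.
under eq_bigr => v _ do rewrite mulr_suml.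
rewrite exchange_big /=; rewrite big_seq [RHS]big_seq; apply: eq_bigr => z zn.
under eq_bigr => v _ do rewrite -mulrA mulrBl mulrBr.
rewrite sumrB -!mulr_sumr -mulrBr; congr (_ * (_ - _)).
  rewrite -(sum_dirac_fun (box_uniq C n.+1) u yn1).
  by apply: eq_bigr => v _; rewrite /dirac_fun eq_sym.
rewrite -(sum_dirac_fun (box_uniq C n.+1) u zn).
by apply: eq_bigr => v _; rewrite /dirac_fun eq_sym.
Qed.

(** Backward equation, uniformly in [t] and [z]. The derivative at 0 is known for each target; only
    the finitely many in [S] are used. The mass outside [S] at time [h] is o(h), because the row of
    the Laplacian at [y] sums to 0 over [S]. *)
Lemma heat_increment (y : C) (e : R) : 0 < e ->
  \forall h \near 0^'+, forall t z, 0 <= t ->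
    `|heat (h + t) y z - heat t y z + h * laplacian w (fun v => heat t v z) y| <= h * e.
Proof.
move=> e0; have [n /(_ _ (leqnn n)) yn] := mem_box_ex y.
set S := box C n.+1; have uS : uniq S by exact: box_uniq.
have yS : y \in S := box_sub (leqnSn n) yn.
have [_ _ _ _ deriv] := vX.
have k0 : 0 < (size S)%:R :> R.
  by rewrite ltr0n; case: (S) yS.
(* The errors summed over [S] occur twice, once against the heat kernel and once against the
   constant 1; each gets half of [h * e]. *)
pose e' := e / (2 * (size S)%:R); have e'0 : 0 < e' by rewrite divr_gt0// mulr_gt0.
have D1 : \forall h \near (0 : R)^'+, forall v, v \in S ->
    `|- laplacian w (dirac_fun R v) y - (heat h y v - (y == v)%:R) / h| <= e'.
  apply: near_all_seq => v _; have /cvgrPdist_le := deriv y v.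
  by move=> /(_ _ e'0).
near=> h; move=> t z t0.
have h0 : 0 < h by near: h; exact: nbhs_right_gt.
have Dh : forall v, v \in S ->
    `|- laplacian w (dirac_fun R v) y - (heat h y v - (y == v)%:R) / h| <= e'.
  by near: h.
pose D v := heat h y v - (y == v)%:R + h * laplacian w (dirac_fun R v) y.
have DD v : v \in S -> `|D v| <= h * e'.
  move=> vS; have := Dh v vS.
  have -> : - laplacian w (dirac_fun R v) y - (heat h y v - (y == v)%:R) / h = - (D v / h).
    by rewrite /D; field; rewrite gt_eqF.
  by rewrite normrN normrM normfV (gtr0_norm h0) ler_pdivrMr// mulrC.
have SD (u : C -> R) : (forall v, `|u v| <= 1) -> `|\sum_(v <- S) D v * u v| <= h * e / 2.
  move=> u1; apply: le_trans (ler_norm_sum _ _ _) _.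
  apply: (@le_trans _ _ (\sum_(v <- S) h * e')).
    rewrite big_seq [leRHS]big_seq; apply: ler_sum => v vS.
    by rewrite normrM -[leRHS]mulr1 ler_pM// DD.
  rewrite big_const_seq count_predT iter_addr_0 -mulr_natr /e'.
  by rewrite le_eqVlt; apply/orP; left; apply/eqP; field; rewrite gt_eqF.
have SE (u : C -> R) : \sum_(v <- S) heat h y v * u v =
    u y - h * lap S W u y + \sum_(v <- S) D v * u v.
  have -> : u y = \sum_(v <- S) (y == v)%:R * u v.
    rewrite -(sum_dirac_fun uS u yS).
    by apply: eq_bigr => v _; rewrite /dirac_fun eq_sym.
  have -> : - (h * lap S W u y) = h * \sum_(v <- S) - laplacian w (dirac_fun R v) y * u v.
    by rewrite laplacian_dirac// mulrN.
  rewrite mulr_sumr -!big_split /=; apply: eq_bigr => v _; rewrite /D; ring.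
have /andP[] := chapman_kolmogorov y z (ltW h0) t0 uS.
have -> : \sum_(v <- S) heat h y v = \sum_(v <- S) heat h y v * 1.
  by apply: eq_bigr => v _; rewrite mulr1.
rewrite (SE (fun v => heat t v z)) (SE (fun=> 1)).
have l1 : lap S W (fun=> 1) y = 0.
  by rewrite /lap big1// => v _; rewrite subrr mulr0.
rewrite l1 mulr0 subr0 (laplacianE cw _ yn) -/S.
have A1 : `|\sum_(v <- S) D v * 1| <= h * e / 2 by apply: SD => v; rewrite normr1.
have A2 : `|\sum_(v <- S) D v * heat t v z| <= h * e / 2.
  by apply: SD => v; rewrite ger0_norm ?heat_ge0// heat_le1.
move: A1 A2; rewrite !ler_norml; set a := \sum_(v <- S) _ * 1; set b := \sum_(v <- S) _.
move=> /andP[a1 a2] /andP[b1 b2] c1 c2.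
by apply/andP; split; lra.
Unshelve. all: by end_near. Qed.

Lemma laplacian_le1 (y : C) : exists2 L : R, 0 <= L &
  forall u : C -> R, (forall z, 0 <= u z <= 1) -> `|laplacian w u y| <= L.
Proof.
have [n /(_ _ (leqnn n)) yn] := mem_box_ex y.
have [w0 _ _] := cw.
exists (\sum_(z <- box C n.+1) W y z) => [|u u1].
  by apply: sumr_ge0 => z _; exact: w0.
rewrite (laplacianE cw _ yn) /lap; apply: le_trans (ler_norm_sum _ _ _) _.
apply: ler_sum => z _; rewrite normrM (ger0_norm (w0 _ _)).
rewrite -[leRHS]mulr1 ler_wpM2l ?w0// ler_norml.
by have := u1 y; have := u1 z; lra.
Qed.

Lemma heat_lipschitz x z : exists2 L : R, 0 <= L &
  \forall h \near 0^'+, forall t, 0 <= t -> `|heat (h + t) x z - heat t x z| <= h * L.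
Proof.
have [L L0 HL] := laplacian_le1 x; exists (L + 1); first lra.
near=> h => t t0; have h0 : 0 < h by near: h; exact: nbhs_right_gt.
have H : `|heat (h + t) x z - heat t x z + h * laplacian w (fun v => heat t v z) x| <= h * 1.
  have H' : forall t z, 0 <= t -> `|heat (h + t) x z - heat t x z
      + h * laplacian w (fun v => heat t v z) x| <= h * 1.
    by near: h; exact: heat_increment.
  exact: H'.
have := HL (fun v => heat t v z); rewrite -(ler_pM2l h0) => H2.
have {}H2 : h * `|laplacian w (fun v => heat t v z) x| <= h * L.
  by apply: H2 => v; rewrite heat_ge0 heat_le1.
have {}H2 : `|h * laplacian w (fun v => heat t v z) x| <= h * L.
  by rewrite normrM (gtr0_norm h0).
move: H H2; rewrite !ler_norml.
by move=> /andP[? ?] /andP[? ?]; apply/andP; split; lra.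
Unshelve. all: by end_near. Qed.

(** The absolute value extends the kernel to a continuous function on the whole line, so that
    one-sided continuity at 0 never arises. *)
Lemma continuous_heat x z : continuous (fun t : R => heat `|t| x z).
Proof.
have [L L0 /near_at_right0[r r0 H]] := heat_lipschitz x z.
have H2 (s t : R) : 0 <= s -> s <= t -> t - s < r -> `|heat t x z - heat s x z| <= (t - s) * L.
  move=> s0; rewrite le_eqVlt orbC => /orP[st|/eqP ->]; last first.
    by rewrite !subrr mul0r normr0.
  move=> ts; rewrite -[X in heat X](subrK s) H ?subr_gt0//.
have H3 (s t : R) : `|s - t| < r -> `|heat `|t| x z - heat `|s| x z| <= `|s - t| * L.
  wlog st : s t / `|s| <= `|t| => [hw|] str.
    have [st|/ltW ts] := lerP `|s| `|t|; first exact: hw.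
    by rewrite distrC [in leRHS]distrC hw// distrC.
  have tsN : `|t| - `|s| <= `|s - t| by rewrite distrC; exact: lerB_dist.
  apply: le_trans (H2 _ _ (normr_ge0 s) st (le_lt_trans tsN str)) _.
  exact: ler_wpM2r.
have L1 : 0 < L + 1 by lra.
move=> t; apply/cvgrPdist_le => e e0; near=> s.
apply: le_trans (H3 s t _) _.
  by rewrite distrC; near: s; apply: cvgr_dist_lt.
apply: (@le_trans _ _ (e / (L + 1) * L)).
  by rewrite ler_wpM2r// distrC; near: s; apply: cvgr_dist_le; [exact: cvg_id|exact: divr_gt0].
by rewrite mulrAC ler_pdivrMr// ler_pM2l//; lra.
Unshelve. all: by end_near. Qed.

(** The telescoping identity without source, for y |-> p_t(y,x): the initial datum is delta_x and
    produces [euler_kernel w n dt x m x]. As the kernel is at most 1, the outflow is bounded with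
    growth exponent 0. *)
Lemma heat_le_euler x T : 0 <= T -> exists2 E : R, 0 <= E &
  forall n, x \in box C n -> forall e : R, 0 < e ->
  \forall dt \near 0^'+, forall m, dt * m%:R <= T ->
    heat (dt * m%:R) x x <= euler_kernel w n dt x m x + E / n.+1%:R + e.
Proof.
move=> T0; have [E E0 HE] := kernel_bounds cw gw 0 T x.
exists (T * E) => [|n xn e e0]; first exact: mulr_ge0.
have [q q0 Hq] := HE n xn.
set S := box C n; have k0 : 0 <= (size S)%:R :> R by [].
pose e' := e / (T * (size S)%:R * E + 1).
have den : 0 < T * (size S)%:R * E + 1 by rewrite ltr_wpDl// !mulr_ge0.
have e'0 : 0 < e' by rewrite divr_gt0.
have near_inc : \forall h \near 0^'+, forall y, y \in S -> forall t z, 0 <= t ->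
    `|heat (h + t) y z - heat t y z + h * laplacian w (fun v => heat t v z) y| <= h * e'.
  by apply: near_all_seq => y _; exact: heat_increment.
near=> dt => m dtm.
have dt0 : 0 < dt by near: dt; exact: nbhs_right_gt.
have dtq : dt * q <= 1.
  by rewrite -ler_pdivlMr// mul1r; near: dt; apply: nbhs_right_le; rewrite invr_gt0.
have inc : forall y, y \in S -> forall t z, 0 <= t ->
    `|heat (dt + t) y z - heat t y z + dt * laplacian w (fun v => heat t v z) y| <= dt * e'.
  by near: dt.
pose u k y := heat (dt * k%:R) y x.
pose r k y := u k.+1 y - u k y + dt * lap (box C n.+1) W (u k) y.
have step k y : (k < m)%N -> y \in S ->
    u k.+1 y = u k y - dt * lap (box C n.+1) W (u k) y + 0 + r k y.
  by move=> _ _; rewrite /r; ring.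
have [w0 wC _] := cw.
have := @euler_telescope R C S (box C n.+1) W (box_uniq C n) (box_uniq C n.+1)
  (box_sub (leqnSn n)) (fun y z => wC _ _) dt x u (fun _ _ => 0) r m xn step.
rewrite /= -/(u m x) => ->.
have -> : \sum_(y <- S) iter m (euler S (box C n.+1) W dt) (dirac_fun R x) y * u 0%N y =
    euler_kernel w n dt x m x.
  rewrite /u mulr0; under eq_bigr do rewrite heat0 mulrC.
  exact: (sum_dirac_fun (box_uniq C n)).
rewrite [X in _ + X + _]big1 ?addr0; last by move=> k _; rewrite big1// => y _; rewrite mulr0.
have jT k : dt * (m - k.+1)%N%:R <= T.
  by apply: le_trans dtm; rewrite ler_wpM2l ?(ltW dt0)// ler_nat leq_subr.
rewrite -addrA -[leRHS]addrA lerD2l; apply: lerD.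
- apply: (@le_trans _ _ (\sum_(k < m) dt * (E / n.+1%:R))).
    apply: ler_sum => k _; rewrite ler_pM2l//; apply: le_trans (ler_norm _) _.
    have [_ Hout] := Hq dt (m - k.+1)%N (ltW dt0) dtq (jT k).
    have := Hout 1 (u k); rewrite mul1r; apply => z.
    by rewrite expr0 mulr1 ger0_norm ?heat_ge0// heat_le1// mulr_ge0// ltW.
  rewrite sumr_const card_ord -[leLHS]mulr_natr.
  have -> : dt * (E / n.+1%:R) * m%:R = dt * m%:R * E / n.+1%:R by ring.
  by rewrite ler_wpM2r ?invr_ge0// ler_wpM2r.
- apply: (@le_trans _ _ (\sum_(k < m) \sum_(y <- S) E * (dt * e'))).
    apply: ler_sum => k _; rewrite big_seq [leRHS]big_seq; apply: ler_sum => y yS.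
    apply: le_trans (ler_norm _) _; rewrite normrM ler_pM//.
      by have [+ _] := Hq dt (m - k.+1)%N (ltW dt0) dtq (jT k); apply.
    rewrite /r -(laplacianE cw _ yS) /u.
    have -> : dt * k.+1%:R = dt + dt * k%:R by rewrite -natr1; ring.
    by apply: inc => //; rewrite mulr_ge0// ltW.
  under eq_bigr do rewrite big_const_seq count_predT iter_addr_0.
  rewrite sumr_const card_ord -[leLHS]mulr_natr -[_ *+ size S]mulr_natr.
  have -> : E * (dt * e') * (size S)%:R * m%:R = (dt * m%:R) * ((size S)%:R * E) * e' by ring.
  rewrite /e' mulrA ler_pdivrMr// mulrC ler_wpM2l ?(ltW e0)//.
  apply: (@le_trans _ _ (T * ((size S)%:R * E))); last by rewrite mulrA lerDl.
  by rewrite ler_wpM2r// mulr_ge0.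
Unshelve. all: by end_near. Qed.

(** A Riemann sum of mesh [2 * dt] samples the times [dt * j.*2], exactly those at which the kernel
    is a sum of squares. *)
Lemma integral_heat_le_euler x T : 0 < T -> exists2 E : R, 0 <= E &
  forall n, x \in box C n -> forall e : R, 0 < e ->
  \forall M \near \oo, let dt := T / M%:R in
    \int[lebesgue_measure]_(s in `[0, 2 * T]) heat `|s| x x <=
    \sum_(j < M) 2 * dt * \sum_(y <- box C n) euler_kernel w n dt x j y ^+ 2
     + E / n.+1%:R + e.
Proof.
move=> T0; have T2 : 0 < 2 * T by rewrite mulr_gt0.
have [E E0 HE] := heat_le_euler x (ltW T2).
have [L L0 HL] := heat_lipschitz x x.
exists (2 * T * E) => [|n xn e e0]; first by rewrite mulr_ge0// ltW.
(* Half of [e] pays for the Riemann sum and half for the comparison with the scheme, both over a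
   length of [2 * T]. *)
pose e' := e / (4 * T); have e'0 : 0 < e' by rewrite divr_gt0// mulr_gt0.
have /near_at_right0[r r0 HLr] := HL.
have L1 : 0 < L + 1 by lra.
have near_dt : \forall dt \near 0^'+, [/\ 0 < dt, 2 * dt < r, 2 * dt * L <= e' & forall m, dt * m%:R <= 2 * T ->
    heat (dt * m%:R) x x <= euler_kernel w n dt x m x + E / n.+1%:R + e'].
  near=> dt; split.
  - by near: dt; exact: nbhs_right_gt.
  - by rewrite mulrC -ltr_pdivlMr//; near: dt; apply: nbhs_right_lt; rewrite divr_gt0.
  - have : dt <= e' / (2 * (L + 1)).
      by near: dt; apply: nbhs_right_le; rewrite divr_gt0// mulr_gt0.
    have dt0 : 0 < dt by near: dt; exact: nbhs_right_gt.
    by rewrite ler_pdivlMr ?mulr_gt0// => ?; lra.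
  - by near: dt; exact: HE.
apply: filterS (near_infty_at_right0 T0 near_dt) => M [M0 [dt0 dtr dtL HM]] /=.
set dt := T / M%:R in dt0 dtr dtL HM *.
have Mn0 : M%:R != 0 :> R by rewrite pnatr_eq0 -lt0n.
have dtM : dt * M%:R = T by rewrite /dt divfK.
have -> : 2 * T = 2 * dt * M%:R by rewrite -mulrA dtM.
have h0 : 0 <= 2 * dt by rewrite mulr_ge0// ltW.
have := @Rintegral_le_riemann R (fun s => heat `|s| x x) (2 * dt) e' M (continuous_heat (x:=x) (z:=x)) h0.
move=> Hriem; apply: le_trans (Hriem _) _ => {Hriem}.
  move=> s k kM /andP[sk ks].
  have k0 : 0 <= 2 * dt * k%:R by rewrite mulr_ge0.
  rewrite (ger0_norm k0) (ger0_norm (le_trans k0 sk)).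
  have [->|sk'] := eqVneq s (2 * dt * k%:R); first by rewrite subrr normr0 ltW.
  have s1 : 0 < s - 2 * dt * k%:R by rewrite subr_gt0 lt_neqAle eq_sym sk'.
  have s2 : s - 2 * dt * k%:R <= 2 * dt by rewrite lerBlDl; apply: le_trans ks _; rewrite -natr1; lra.
  have := HLr _ s1 (le_lt_trans s2 dtr) _ k0; rewrite subrK => H.
  by apply: le_trans H _; apply: le_trans dtL; rewrite ler_wpM2r.
have -> : 2 * dt * M%:R * e' = e / 2.
  by rewrite -[2 * dt * _]mulrA dtM /e'; field; rewrite gt_eqF.
apply: (@le_trans _ _ (\sum_(j < M) (2 * dt * (\sum_(y <- box C n) euler_kernel w n dt x j y ^+ 2) + 2 * dt * (E / n.+1%:R + e')) + e / 2)).
  rewrite lerD2r; apply: ler_sum => j _; rewrite -mulrDr ler_wpM2l//.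
  have [_ wC _] := cw.
  rewrite (@sum_iter_euler_sqr R C (box C n) (box C n.+1) W (box_uniq C n) (box_uniq C n.+1)
    (box_sub (leqnSn n)) (fun y z => wC _ _))//.
  rewrite ger0_norm; last by rewrite mulr_ge0.
  have -> : 2 * dt * j%:R = dt * (j.*2)%:R by rewrite -mul2n natrM; ring.
  rewrite addrA; apply: HM.
  have -> : dt * (j.*2)%:R = 2 * (dt * j%:R) by rewrite -mul2n natrM; ring.
  by rewrite ler_wpM2l// -dtM ler_wpM2l ?(ltW dt0)// ler_nat ltnW.
rewrite big_split /= sumr_const card_ord -[_ *+ M]mulr_natr.
have -> : 2 * dt * (E / n.+1%:R + e') * M%:R = 2 * dt * M%:R * E / n.+1%:R + (2 * (dt * M%:R)) * e'.
  by ring.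
have -> : 2 * (dt * M%:R) * e' = e / 2.
  by rewrite dtM /e'; field; rewrite gt_eqF.
by rewrite [X in X + _ <= _]addrA -[leLHS]addrA -splitr.
Unshelve. all: by end_near. Qed.

Lemma green_le x (c : R) :
  (forall T, 0 < T -> \int[lebesgue_measure]_(s in `[0, 2 * T]) heat `|s| x x <= c) ->
  (green PX X x x <= c%:E)%E.
Proof.
move=> Hc; rewrite /green.
rewrite (_ : `[0%R, +oo[%classic = \bigcup_(i : nat) `[0%R, 2 * i.+1%:R]%classic); last first.
  apply/seteqP; split => s /=; last first.
    by move=> [i _]; rewrite /= !in_itv /= => /andP[->].
  rewrite in_itv /= andbT => s0; exists (Num.trunc s) => //=.
  rewrite in_itv /= s0 /=; have := Num.Theory.truncnS_gt s.
  by have : 0 <= (Num.trunc s).+1%:R :> R by []; lra.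
have heatI i : (\int[lebesgue_measure]_(t in `[0%R, (2 * i.+1%:R)%R]) transition PX X t x x =
    (\int[lebesgue_measure]_(s in `[0, 2 * i.+1%:R]) heat `|s| x x)%:E)%E.
  rewrite /Rintegral fineK; last first.
    apply: integrable_fin_num => //; apply: continuous_itv_integrable.
    exact: continuous_heat.
  apply: eq_integral => t; rewrite inE /= in_itv /= => /andP[t0 _].
  by rewrite heatE// ger0_norm.
have tE t : 0 <= t -> transition PX X t x x = (heat `|t| x x)%:E.
  by move=> t0; rewrite heatE// ger0_norm.
pose F (i : nat) : set (measurableTypeR R) := `[0%R, 2 * i.+1%:R]%classic.
have ndF : nondecreasing_seq F.
  move=> i j ij; apply/subsetPset => s; rewrite /F /= !in_itv /= => /andP[-> si] /=.
  by apply: le_trans si _; rewrite ler_pM2l// ler_nat.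
have mF i : measurable (F i) by exact: measurable_itv.
pose k : measurableTypeR R -> \bar R := fun t => (heat `|t : R| x x)%:E.
have mf i : measurable_fun (F i) (fun t => transition PX X t x x).
  apply: (eq_measurable_fun k) => [t|].
    by rewrite inE /F /= in_itv /= => /andP[t0 _]; rewrite tE.
  apply/measurable_EFinP; apply: measurable_funTS.
  by apply: continuous_measurable_fun; exact: continuous_heat.
have f0 i t : F i t -> (0 <= transition PX X t x x)%E by [].
have cvg := ge0_nondecreasing_set_cvg_integral (mu := lebesgue_measure) ndF mF mf f0.
rewrite -(cvg_lim _ cvg)//; apply: lime_le; first by apply/cvg_ex; eexists; exact: cvg.
by apply: nearW => i; rewrite heatI lee_fin; apply: Hc.
Qed.

End chain.

(** * Paths of the equation *)

Section tempered_paths.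
Variables (R : realType) (d : nat) (w : Zd d -> Zd d -> R) (C : set (Zd d)).
Hypothesis cw : conductances w.

Lemma le_Hneg_norm2 N (f : C -> R) (z : C) :
  (((bracket2 R (val z) ^+ N)^-1 * `|f z| ^+ 2)%:E <= Hneg_norm2 N f)%E.
Proof.
rewrite /Hneg_norm2; apply: esum_ge; exists [set z]; first by split.
by rewrite fsbig_set1 exprM jbracket_sqr.
Qed.

Lemma sqr_le_weight (a b r : R) : 0 <= r -> 1 <= b -> b^-1 * `|a| ^+ 2 <= r -> `|a| <= (1 + r) * b.
Proof.
move=> r0 b1 H; have b0 : 0 < b by exact: lt_le_trans b1.
have {}H : `|a| ^+ 2 <= r * b by rewrite -ler_pdivrMr// mulrC.
rewrite -(@ler_pXn2r _ 2)// ?nnegrE ?mulr_ge0 ?addr_ge0 ?(ltW b0)//.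
by apply: le_trans H _; rewrite exprMn ler_pM ?(ltW b0)//; nra.
Qed.

(** Compactness of [0, T]: near each time the path stays within squared norm 1 of its value there.
    The constant [K] depends on the path. *)
Lemma Hneg_path_bounded N (phi : R -> C -> R) T : Hneg_continuous N phi -> exists K : R,
  forall t, 0 <= t <= T -> forall z, `|phi t z| <= K * bracket2 R (val z) ^+ N.
Proof.
move=> Hphi; have V1 (z : C) : 1 <= bracket2 R (val z) ^+ N.
  by rewrite exprn_ege1// bracket2_ge1.
have /compact_near_coveringP cpt := @segment_compact R 0 T.
have [] := cpt R (pinfty_nbhs R)
  (fun K t => 0 <= t -> forall z, `|phi t z| <= K * bracket2 R (val z) ^+ N) _.
  move=> t; rewrite /= in_itv /= => /andP[t0 tT]; have [Ht Hcvg] := Hphi t t0.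
  have [r [r0 Hr]] : exists r, 0 <= r /\ (Hneg_norm2 N (phi t) <= r%:E)%E.
    have H0 : (0 <= Hneg_norm2 N (phi t))%E.
      apply: esum_ge0 => z _; rewrite lee_fin mulr_ge0// ?exprn_ge0//.
      by rewrite invr_ge0 exprn_ge0// /jbracket sqrtr_ge0.
    by move: Ht H0; rewrite /Hneg /=; case: (Hneg_norm2 _ _) => // r _ r0; exists r.
  have near1 : \forall s \near t, 0 <= s -> (Hneg_norm2 N (fun x => (phi s x - phi t x)%R) <= 1%:E)%E.
    have : nbhs (0 : \bar R)%E [set e | (e < 1%:E)%E].
      by apply: open_nbhs_nbhs; split; [exact: open_ereal_lt_ereal|rewrite /= lte_fin].
    move=> /Hcvg H.
    have {}H : \forall s \near t, 0 <= s -> (Hneg_norm2 N (fun x => (phi s x - phi t x)%R) < 1%:E)%E := H.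
    by apply: filterS H => s H s0; apply: ltW; exact: (H s0).
  (* [1 + 1] bounds the deviation from [phi t] and [1 + r] bounds [phi t], both through
     [sqr_le_weight]. *)
  exists ([set s | 0 <= s -> (Hneg_norm2 N (fun x => (phi s x - phi t x)%R) <= 1%:E)%E],
          [set K | 1 + 1 + (1 + r) <= K]).
    by split => //=; apply: nbhs_pinfty_ge; exact: num_real.
  move=> [s K] /= [Hs' HK] s0 z; have Hs := Hs' s0.
  have A1 : `|phi s z - phi t z| <= (1 + 1) * bracket2 R (val z) ^+ N.
    by apply: sqr_le_weight => //; rewrite -lee_fin; exact: le_trans (le_Hneg_norm2 N _ z) Hs.
  have A2 : `|phi t z| <= (1 + r) * bracket2 R (val z) ^+ N.
    apply: sqr_le_weight => //; rewrite -lee_fin.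
    exact: le_trans (le_Hneg_norm2 N _ z) Hr.
  have A3 : `|phi s z| <= `|phi s z - phi t z| + `|phi t z|.
    by rewrite -{1}(subrK (phi t z) (phi s z)) ler_normD.
  apply: le_trans A3 _; apply: le_trans (lerD A1 A2) _.
  by rewrite -mulrDl ler_wpM2r//; exact: le_trans ler01 (V1 z).
move=> K [_ HK]; exists (K + 1) => t /andP[t0 tT].
by apply: (HK (K + 1)) => //=; [lra|rewrite in_itv /= t0].
Qed.

Lemma Hneg_path_continuous N (phi : R -> C -> R) z : Hneg_continuous N phi ->
  continuous (fun t : R => phi `|t| z).
Proof.
move=> Hphi t; have [_ Hcvg] := Hphi `|t| (normr_ge0 t).
apply/cvgrPdist_lt => e e0.
have V0 : 0 < bracket2 R (val z) ^+ N by rewrite exprn_gt0// bracket2_gt0.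
have : nbhs (0 : \bar R)%E [set r | (r < ((bracket2 R (val z) ^+ N)^-1 * e ^+ 2)%:E)%E].
  apply: open_nbhs_nbhs; split; [exact: open_ereal_lt_ereal|rewrite /= lte_fin].
  by rewrite mulr_gt0 ?invr_gt0// exprn_gt0.
move=> /Hcvg H0.
have H : \forall s \near `|t|, 0 <= s ->
  (Hneg_norm2 N (fun x => (phi s x - phi `|t| x)%R) < ((bracket2 R (val z) ^+ N)^-1 * e ^+ 2)%:E)%E := H0.
have H1 : \forall s \near t, 0 <= `|s| -> (Hneg_norm2 N (fun x => (phi `|s| x - phi `|t| x)%R)
    < ((bracket2 R (val z) ^+ N)^-1 * e ^+ 2)%:E)%E := @norm_continuous _ R t _ H.
apply: filterS H1 => s /= /(_ (normr_ge0 s)) Hs.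
have := le_lt_trans (le_Hneg_norm2 N _ z) Hs.
rewrite lte_fin ltr_pM2l ?invr_gt0// ltr_pXn2r ?nnegrE ?normr_ge0 ?(ltW e0)//.
by rewrite distrC.
Qed.

Lemma unif_continuous_itv (g : R -> R) T e : continuous g -> 0 < e ->
  \forall r \near 0^'+, forall s t, 0 <= s <= T -> `|s - t| <= r -> `|g s - g t| <= e.
Proof.
move=> cg e0; have /compact_near_coveringP cpt := @segment_compact R 0 T.
have := cpt R (at_right 0) (fun r s => forall t, `|s - t| <= r -> `|g s - g t| <= e) _.
move=> H; have {}H : \forall r \near 0^'+, `[0, T] `<=` (fun s : R => forall t : R, `|s - t| <= r -> `|g s - g t| <= e).
  apply: H => s _; have /cvgrPdist_le/(_ _ (divr_gt0 e0 (ltr0n _ 2))) [r /= r0 Hr] := cg s.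
  have r2 : 0 < r / 2 by rewrite divr_gt0.
  near=> s' dr => t s't.
  have ss' : `|s - s'| < r / 2 by near: s'; exact: cvgr_dist_lt.
  have dr2 : dr < r / 2 by near: dr; exact: nbhs_right_lt.
  have A1 : `|g s - g s'| <= e / 2 by apply: Hr => /=; apply: lt_trans ss' _; rewrite ltr_pdivrMr// ltr_pMr// ltr1n.
  have A2 : `|g s - g t| <= e / 2.
    by apply: Hr => /=; apply: le_lt_trans (ler_distD s' s t) _; rewrite [ltRHS]splitr ltr_leD// (le_trans s't)// ltW.
  by apply: le_trans (ler_distD (g s) (g s') (g t)) _; rewrite (distrC (g s') (g s)) [leRHS]splitr lerD.
by apply: filterS H => r H s t sT; apply: H; rewrite /= in_itv.
Unshelve. all: by end_near. Qed.

Lemma continuous_laplacian (f : R -> C -> R) y :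
  (forall z, continuous (fun t : R => f `|t| z)) ->
  continuous (fun t : R => laplacian w (f `|t|) y).
Proof.
move=> cf; have [n /(_ _ (leqnn n)) yn] := mem_box_ex y.
rewrite (_ : (fun t => _) = (fun t : R => lap (box C n.+1) (edge_weight w (C:=C)) (f `|t|) y)).
  rewrite /lap; elim: (box C n.+1) => [|z s IH].
    by under eq_fun do rewrite big_nil; move=> t; exact: cvg_cst.
  under eq_fun do rewrite big_cons; move=> t; apply: cvgD; last exact: IH.
  by apply: cvgM; [exact: cvg_cst|apply: cvgB; exact: cf].
by apply/funext => t; rewrite (laplacianE cw _ yn).
Qed.

(** A pathwise statement: the additive noise cancels exactly, and the drift is continuous in time,
    hence uniformly so on [0, T]. *)
Lemma sde_increment (f : R -> C -> R) (f0 : C -> R) (b : C -> R -> R) y T e :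
  (forall z, continuous (fun t : R => f `|t| z)) ->
  (forall z t, 0 <= t -> f t z = f0 z
     + \int[lebesgue_measure]_(s in `[0, t]) (- laplacian w (f s) z) + Num.sqrt 2 * b z t) ->
  0 < e ->
  \forall h \near 0^'+, forall t, 0 <= t -> t + h <= T ->
    `|f (t + h) y - f t y + h * laplacian w (f t) y
      - Num.sqrt 2 * (b y (t + h) - b y t)| <= h * e.
Proof.
move=> cf eqf e0.
pose g (s : R) := - laplacian w (f `|s|) y.
have cg : continuous g by move=> s; apply: cvgN; exact: continuous_laplacian.
pose J (t : R) := \int[lebesgue_measure]_(s in `[0, t]) g s.
have gE t : \int[lebesgue_measure]_(s in `[0, t]) (- laplacian w (f s) y) = J t.
  apply: eq_Rintegral => s; rewrite inE /= in_itv /= => /andP[s0 _].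
  by rewrite /g ger0_norm.
near=> h => t t0 thT.
have h0 : 0 < h by near: h; exact: nbhs_right_gt.
have th0 : 0 <= t + h by lra.
have hU : forall s t, 0 <= s <= T -> `|s - t| <= h -> `|g s - g t| <= e.
  by near: h; exact: unif_continuous_itv.
have tth : t <= t + h by lra.
have H : (forall s, t <= s <= t + h -> `|g s - g t| <= e) -> `|J (t + h) - J t - h * g t| <= h * e.
  move=> /(@Rintegral_increment R g t (t + h) (g t) e cg t0 tth).
  by have -> : t + h - t = h by ring.
rewrite !eqf// !gE.
have -> : laplacian w (f t) y = - g t by rewrite /g opprK ger0_norm.
have -> : f0 y + J (t + h) + Num.sqrt 2 * b y (t + h) - (f0 y + J t + Num.sqrt 2 * b y t)
   + h * - g t - Num.sqrt 2 * (b y (t + h) - b y t) = J (t + h) - J t - h * g t by ring.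
apply: H => s /andP[ts sth]; rewrite distrC; apply: hU; first by lra.
by rewrite ler_norml; lra.
Unshelve. all: by end_near. Qed.

End tempered_paths.

(** * Characteristic function of a solution *)

Section bounded_convergence.
Context d (T : measurableType d) (R : realType) (P : probability T R).

Lemma bounded_cvg0 (f : nat -> T -> R) (M : R) :
  (forall n, measurable_fun setT (f n)) -> (forall n x, `|f n x| <= M) ->
  {ae P, forall x, f ^~ x @ \oo --> (0 : R)} ->
  \int[P]_x f n x @[n --> \oo] --> (0 : R).
Proof.
move=> mf fM f0.
have := @dominated_convergence _ T R P setT measurableT
  (fun n x => (f n x)%:E) (cst 0%E) (cst M%:E)
  (fun n => (measurable_EFinP setT (f n)).2 (mf n)) (measurable_cst _).
case.
- apply: filterS f0 => x fx _; apply/fine_cvgP; split; first exact: nearW.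
  exact: fx.
- apply: (@bounded_integrable _ _ _ P `|M| (cst M)) => //.
- by apply: aeW => x n _; rewrite /= lee_fin.
move=> _ _; rewrite integral0 => H.
by have /fine_cvgP[] := H.
Qed.

End bounded_convergence.

Lemma cos_lipschitz (R : realType) (a b : R) : `|cos a - cos b| <= `|a - b|.
Proof.
wlog ab : a b / b <= a => [hw|].
  have /orP[ba|ba] := le_total b a; first exact: hw.
  by rewrite distrC (distrC a); exact: hw.
have [|c _ ->] := @MVT_segment R cos (fun y => - sin y) b a ab (fun y _ => is_derive_cos y).
  exact/continuous_subspaceT/continuous_cos.
by rewrite normrM normrN ler_piMl// sin_max.
Qed.

Section cos_sde.
Variables (R : realType) (d : nat) (w : Zd d -> Zd d -> R) (C : set (Zd d)).
Variables (dX : measure_display) (OmX : measurableType dX).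
Variables (PX : C -> probability OmX R) (X : R -> OmX -> C).
Variables (dO : measure_display) (Om : measurableType dO) (P : probability Om R).
Variables (Fil : R -> set (set Om)) (B : C -> R -> Om -> R).
Hypotheses (cw : conductances w) (gw : growth_assumption w).
Hypothesis vX : variable_speed_random_walk w PX X.
Hypotheses (filF : filtration Fil) (bmB : independent_brownian_motions P Fil B).

Section solution.
Variables (phi0 : SprimeType R C) (phi : R -> Om -> SprimeType R C).
Hypothesis sol : sde_solution w P Fil B phi0 phi.
Variables (x : C) (T th : R).
Hypothesis T0 : 0 < T.

Let f om t z : R := val (phi t om) z.
Let a n M j := euler_kernel w n (T / M%:R) x j.
Let coef n M k y := th * Num.sqrt 2 * a n M (M - k.+1)%N y.
Let noise n M om := brownian_sum B (T / M%:R) (coef n M) (box C n) M om.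
Let mean n M := th * \sum_(y <- box C n) a n M M y * val phi0 y.
Let Rout n M om := th * \sum_(k < M) T / M%:R *
  box_outflow w n (a n M (M - k.+1)%N) (f om (T / M%:R * k%:R)).
(** Defined as the remainder of the decomposition of [th * f om T x], so that its measurability
    follows from that of the other terms; that it is the discretisation error is the content of
    [Rdisc_cvg0]. *)
Let Rdisc n M om := th * f om T x - mean n M - noise n M om - Rout n M om.

Lemma solution_measurable t z : 0 <= t -> measurable_fun setT (fun om => f om t z).
Proof.
move=> t0; have [ad _ _] := sol.
by apply: (past_measurable_fun filF t0) => A mA; exact: ad.
Qed.

Lemma noise_measurable n M : measurable_fun setT (fun om => mean n M + noise n M om).
Proof.
have h0 : 0 <= T / M%:R by rewrite divr_ge0// ltW.
apply: (past_measurable_fun filF (mulr_ge0 h0 (ler0n _ M))).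
exact: (past_measurable_brownian_sum filF bmB).
Qed.

Lemma Rout_measurable n M : measurable_fun setT (Rout n M).
Proof.
have h0 : 0 <= T / M%:R by rewrite divr_ge0// ltW.
apply: measurable_funM => //; apply: measurable_sum => k; apply: measurable_funM => //.
rewrite /box_outflow /outflow; apply: measurable_sum => y.
under eq_fun do rewrite -big_filter.
apply: measurable_sum => z; apply: measurable_funM => //.
by apply: solution_measurable; rewrite mulr_ge0.
Qed.

Lemma Rdisc_measurable n M : measurable_fun setT (Rdisc n M).
Proof.
have E : Rdisc n M = (fun om => th * f om T x - (mean n M + noise n M om) - Rout n M om).
  by apply/funext => om; rewrite /Rdisc opprD addrA.
rewrite E; apply: measurable_funB; last exact: Rout_measurable.
apply: measurable_funB; last exact: noise_measurable.
by apply: measurable_funM => //; apply: solution_measurable; exact: ltW.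
Qed.

(** [E] and the threshold for [M] are deterministic; the randomness is confined to [K]. *)
Lemma Rout_bound N : exists2 E : R, 0 <= E & forall n, x \in box C n ->
  \forall M \near \oo, forall om K,
    (forall t, 0 <= t <= T -> forall z, `|f om t z| <= K * bracket2 R (val z) ^+ N) ->
    `|Rout n M om| <= K * E / n.+1%:R.
Proof.
have [E E0 HE] := kernel_bounds cw gw N T x.
exists (`|th| * T * E) => [|n xn]; first by rewrite !mulr_ge0// ltW.
have [q q0 Hq] := HE n xn.
have near_dt : \forall dt \near 0^'+, 0 < dt /\ dt * q <= 1.
  near=> dt; split; first by near: dt; exact: nbhs_right_gt.
  rewrite -ler_pdivlMr// mul1r; near: dt; apply: nbhs_right_le; rewrite invr_gt0//.
apply: filterS (near_infty_at_right0 T0 near_dt) => M [M0 [dt0 dtq]] om K HK.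
have Mn0 : M%:R != 0 :> R by rewrite pnatr_eq0 -lt0n.
rewrite /Rout; set dt := T / M%:R in dt0 dtq *.
have dtM : dt * M%:R = T by rewrite /dt divfK.
rewrite normrM.
have -> : K * (`|th| * T * E) / n.+1%:R = `|th| * (\sum_(k < M) dt * (K * E / n.+1%:R)).
  rewrite sumr_const card_ord -[_ *+ M]mulr_natr -dtM; ring.
rewrite ler_wpM2l//; apply: le_trans (ler_norm_sum _ _ _) _.
apply: ler_sum => k _; rewrite normrM (gtr0_norm dt0) ler_pM2l//.
have jT j : (j <= M)%N -> dt * j%:R <= T.
  by move=> jM; rewrite -dtM ler_wpM2l ?(ltW dt0)// ler_nat.
have [_ Hout] := Hq dt (M - k.+1)%N (ltW dt0) dtq (jT _ (leq_subr _ _)).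
apply: Hout => z; apply: HK; rewrite mulr_ge0 ?(ltW dt0)//=.
by apply: jT; exact: ltnW.
Unshelve. all: by end_near. Qed.

(** By the telescoping identity the remainder is, up to the factor [th], the pairing of the kernel
    with the errors of [sde_increment]: about T/dt steps, each of size dt * e'. A single null set
    serves all boxes. *)
Lemma Rdisc_cvg0 : {ae P, forall om, forall n, x \in box C n ->
  Rdisc n M om @[M --> \oo] --> (0 : R)}.
Proof.
have [_ [N Hcont] Heq] := sol.
apply: filterS2 Hcont Heq => om Hcont Heq n xn.
have cf z : continuous (fun t : R => f om `|t| z).
  by apply: Hneg_path_continuous Hcont.
have [E E0 HE] := kernel_bounds cw gw 0 T x.
have [q q0 Hq] := HE n xn.
have f00 y : f om 0 y = val phi0 y.
  have := Heq y 0 (lexx _); rewrite set_itv1 Rintegral_set1 addr0.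
  by have [-> _ _ _] := bmB; rewrite mulr0 addr0.
apply/cvgrPdist_le => e e0.
set S := box C n; have k0 : 0 <= (size S)%:R :> R by [].
pose den := `|th| * (T * (size S)%:R * E) + 1.
have den0 : 0 < den by rewrite ltr_wpDl// !mulr_ge0// ltW.
pose e' := e / den; have e'0 : 0 < e' by rewrite divr_gt0.
have near_inc : \forall h \near 0^'+, forall y, y \in S -> forall t, 0 <= t -> t + h <= T ->
    `|f om (t + h) y - f om t y + h * laplacian w (f om t) y
      - Num.sqrt 2 * (B y (t + h) om - B y t om)| <= h * e'.
  apply: near_all_seq => y _.
  exact: (@sde_increment R d w C cw (f om) (val phi0) (fun y t => B y t om) y T e' cf Heq e'0).
have near_dt : \forall dt \near 0^'+, [/\ 0 < dt, dt * q <= 1 &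
   forall y, y \in S -> forall t, 0 <= t -> t + dt <= T ->
    `|f om (t + dt) y - f om t y + dt * laplacian w (f om t) y
      - Num.sqrt 2 * (B y (t + dt) om - B y t om)| <= dt * e'].
  near=> dt; split.
  - by near: dt; exact: nbhs_right_gt.
  - by rewrite -ler_pdivlMr// mul1r; near: dt; apply: nbhs_right_le; rewrite invr_gt0.
  - by near: dt.
apply: filterS (near_infty_at_right0 T0 near_dt) => M [M0 [dt0 dtq inc]].
have Mn0 : M%:R != 0 :> R by rewrite pnatr_eq0 -lt0n.
rewrite /Rdisc /Rout /noise /brownian_sum /mean /coef /a.
set dt := T / M%:R in dt0 dtq inc *.
have dtM : dt * M%:R = T by rewrite /dt divfK.
have jT j : (j <= M)%N -> dt * j%:R <= T.
  by move=> jM; rewrite -dtM ler_wpM2l ?(ltW dt0)// ler_nat.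
pose u k y := f om (dt * k%:R) y.
pose b k y := Num.sqrt 2 * (B y (dt * k.+1%:R) om - B y (dt * k%:R) om).
pose r k y := u k.+1 y - u k y + dt * lap (box C n.+1) (edge_weight w (C:=C)) (u k) y - b k y.
have step k y : (k < M)%N -> y \in S ->
    u k.+1 y = u k y - dt * lap (box C n.+1) (edge_weight w (C:=C)) (u k) y + b k y + r k y.
  by move=> _ _; rewrite /r; ring.
have [_ wC _] := cw.
have := @euler_telescope R C S (box C n.+1) (edge_weight w (C:=C)) (box_uniq C n)
  (box_uniq C n.+1) (box_sub (leqnSn n)) (fun y z => wC _ _) dt x u b r M xn step.
rewrite /= {1}/u dtM => ->.
set A1 := \sum_(y <- S) _; set A2 := \sum_(k < M) dt * _.
set A3 := \sum_(k < M) \sum_(y <- S) _; set A4 := \sum_(k < M) \sum_(y <- S) _.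
set A1' := \sum_(y <- _) _; set A3' := \sum_(k < M) \sum_(y <- _) _.
have -> : A1' = A1.
  by apply: eq_bigr => y _; rewrite /u mulr0 f00.
have -> : A3' = th * A3.
  rewrite /A3' /A3 mulr_sumr; apply: eq_bigr => k _; rewrite mulr_sumr.
  by apply: eq_bigr => y _; rewrite /b /euler_kernel; ring.
have -> : 0 - (th * (A1 + A2 + A3 + A4) - th * A1 - th * A3 - th * A2) = - (th * A4) by ring.
rewrite normrN normrM.
have HA4 : `|A4| <= T * (size S)%:R * E * e'.
  apply: le_trans (ler_norm_sum _ _ _) _.
  apply: (@le_trans _ _ (\sum_(k < M) \sum_(y <- S) E * (dt * e'))); last first.
    under eq_bigr do rewrite big_const_seq count_predT iter_addr_0.
    rewrite sumr_const card_ord -[leLHS]mulr_natr -[_ *+ size S]mulr_natr -dtM.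
    by rewrite le_eqVlt; apply/orP; left; apply/eqP; ring.
  apply: ler_sum => k _; apply: le_trans (ler_norm_sum _ _ _) _.
  rewrite big_seq [leRHS]big_seq; apply: ler_sum => y yS.
  rewrite normrM ler_pM//.
    by have [+ _] := Hq dt (M - k.+1)%N (ltW dt0) dtq (jT _ (leq_subr _ _)); apply.
  rewrite /r -(laplacianE cw _ yS) /u /b.
  have Ek : dt * k.+1%:R = dt * k%:R + dt by rewrite -natr1; ring.
  rewrite Ek; apply: inc => //; first by rewrite mulr_ge0// ltW.
  by rewrite -Ek; exact: jT.
apply: le_trans (ler_wpM2l (normr_ge0 th) HA4) _.
rewrite /e' mulrA mulrA ler_pdivrMr// mulrC ler_wpM2l ?(ltW e0)//.
by rewrite /den lerDl.
Unshelve. all: by end_near. Qed.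

(** Two cosines differ by at most 2, which allows the truncation; the truncated errors can be
    integrated without any moment of the solution. *)
Lemma cos_sub_le n M om :
  `|cos (th * f om T x) - cos (mean n M + noise n M om)| <=
  Num.min 2 `|Rout n M om| + Num.min 2 `|Rdisc n M om|.
Proof.
set z := mean n M + noise n M om.
have := cos_lipschitz (th * f om T x) z.
have -> : th * f om T x - z = Rout n M om + Rdisc n M om by rewrite /z /Rdisc; ring.
have := ler_normD (Rout n M om) (Rdisc n M om).
have := ler_normB (cos (th * f om T x)) (cos z).
have := cos_max z; have := cos_max (th * f om T x).
have := normr_ge0 (Rout n M om); have := normr_ge0 (Rdisc n M om).
by rewrite /Num.min; do 2 case: ifP; lra.
Qed.

End solution.

Lemma cos_sde_bound : exists2 k : R, 0 < k &
  forall phi0 phi, sde_solution w P Fil B phi0 phi -> forall (x : C) (T th : R), 0 < T ->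
  `|\int[P]_om cos (th * val (phi T om) x)| <=
  expR (- (k * th ^+ 2 * \int[lebesgue_measure]_(s in `[0, 2 * T]) heat PX X `|s| x x)).
Proof.
have [k k0 Hk] := cos_brownian_sum filF bmB; exists k => // phi0 phi sol x T th T0.
set I := (X in expR (- (_ * X))).
pose a n M j := euler_kernel w n (T / M%:R) x j.
pose coef n M j y := th * Num.sqrt 2 * a n M (M - j.+1)%N y.
pose noise n M om := brownian_sum B (T / M%:R) (coef n M) (box C n) M om.
pose mean n M := th * \sum_(y <- box C n) a n M M y * val phi0 y.
pose Rt n M om := th * \sum_(j < M) T / M%:R *
  box_outflow w n (a n M (M - j.+1)%N) (val (phi (T / M%:R * j%:R) om)).
pose Rd n M om := th * val (phi T om) x - mean n M - noise n M om - Rt n M om.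
have mRt n M : measurable_fun setT (Rt n M) by exact: (Rout_measurable sol x th T0 n M).
have mRd n M : measurable_fun setT (Rd n M) by exact: (Rdisc_measurable sol x th T0 n M).
have mN n M : measurable_fun setT (fun om => mean n M + noise n M om).
  by exact: (noise_measurable phi0 x th T0 n M).
have [E2 E20 HE2] := integral_heat_le_euler cw gw vX x T0.
have noise_bound n e : x \in box C n -> 0 < e -> \forall M \near \oo,
   `|\int[P]_om cos (mean n M + noise n M om)| <= expR (- (k * th ^+ 2 * (I - E2 / n.+1%:R - e))).
  move=> xn e0.
  have [E E0 HE] := kernel_bounds cw gw 0 T x; have [q q0 Hq] := HE n xn.
  (* [dt * D <= 1] ensures the smallness condition of [cos_brownian_sum], as the squared
     coefficients are at most 2 th^2 E^2. *)
  pose D := 2 * th ^+ 2 * E ^+ 2 + 1.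
  have D0 : 0 < D by have := mulr_ge0 (sqr_ge0 th) (sqr_ge0 E); rewrite /D; lra.
  have near_dt : \forall dt \near 0^'+, [/\ 0 < dt, dt * q <= 1 & dt * D <= 1].
    near=> dt; split; first by near: dt; exact: nbhs_right_gt.
    - by rewrite -ler_pdivlMr// mul1r; near: dt; apply: nbhs_right_le; rewrite invr_gt0.
    - by rewrite -ler_pdivlMr// mul1r; near: dt; apply: nbhs_right_le; rewrite invr_gt0.
  apply: filterS2 (near_infty_at_right0 T0 near_dt) (HE2 n xn e e0) => M [M0 [dt0 dtq dtD]] HI.
  have Mn0 : M%:R != 0 :> R by rewrite pnatr_eq0 -lt0n.
  have dtM : T / M%:R * M%:R = T by rewrite divfK.
  have jT j : (j <= M)%N -> T / M%:R * j%:R <= T.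
    by move=> jM; rewrite -[leRHS]dtM ler_wpM2l ?(ltW dt0)// ler_nat.
  apply: le_trans (Hk _ _ _ _ _ dt0 (box_uniq C n) _) _.
    move=> j y jM yn; rewrite -(@ler_pXn2r _ 2)// ?nnegrE ?mulr_ge0 ?sqrtr_ge0//.
    rewrite exprMn sqr_sqrtr ?(ltW dt0)// expr1n real_normK ?num_real//.
    rewrite /coef !exprMn sqr_sqrtr//; apply: le_trans dtD; rewrite mulrC ler_wpM2l ?(ltW dt0)//.
    have [+ _] := Hq _ (M - j.+1)%N (ltW dt0) dtq (jT _ (leq_subr _ _)).
    move=> /(_ y) aE; have : a n M (M - j.+1)%N y ^+ 2 <= E ^+ 2.
      by rewrite -real_normK ?num_real// lerXn2r ?nnegrE.
    by have := sqr_ge0 th; rewrite /D; nra.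
  rewrite ler_expR lerN2.
  have -> : k * (T / M%:R) * (\sum_(j < M) \sum_(y <- box C n) coef n M j y ^+ 2) =
    k * th ^+ 2 * (\sum_(j < M) 2 * (T / M%:R) * \sum_(y <- box C n) a n M j y ^+ 2).
    (* The noise coefficients run through the kernel backwards in time; the factor 2 is the square
       of the [Num.sqrt 2] in the equation. *)
    rewrite [in RHS](reindex_inj rev_ord_inj) /= !mulr_sumr; apply: eq_bigr => j _.
    rewrite !mulr_sumr; apply: eq_bigr => y _.
    by rewrite /coef !exprMn sqr_sqrtr//; ring.
  rewrite ler_wpM2l//; first exact: mulr_ge0 (ltW k0) (sqr_ge0 th).
  by rewrite !lerBlDr addrAC; exact: HI.
have Rd_cvg n : x \in box C n -> \int[P]_om Num.min 2 `|Rd n M om| @[M --> \oo] --> (0 : R).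
  move=> xn; apply: (@bounded_cvg0 _ _ R P (fun M om => Num.min 2 `|Rd n M om|) 2).
  - move=> M; apply: measurable_minr => //; exact: measurableT_comp.
  - move=> M om; rewrite ger0_norm; first by rewrite ge_min lexx.
    by rewrite le_min normr_ge0 ler0n.
  apply: filterS (Rdisc_cvg0 sol x th T0) => om H.
  have {}H : Rd n M om @[M --> \oo] --> (0 : R) := H n xn.
  apply/cvgrPdist_le => e e0; near=> M.
  rewrite sub0r normrN ger0_norm ?le_min ?normr_ge0 ?ler0n//.
  rewrite ge_min; apply/orP; right.
  rewrite -normrN -[- _]sub0r; near: M; exact: cvgr_dist_le.
have [n0 Hn0] := mem_box_ex x.
have [_ [N Hcont] Heq] := sol.
have [E E0 HE] := Rout_bound phi x th T0 N.
(* The discretisation error tends to 0 at a rate depending on the path, so M is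
   chosen after n, from the expectation of the truncated error. *)
have pick n : exists M, [/\ `|\int[P]_om cos (mean (n0 + n)%N M + noise (n0 + n)%N M om)|
        <= expR (- (k * th ^+ 2 * (I - E2 / (n0 + n).+1%:R - n.+1%:R^-1))),
    \int[P]_om Num.min 2 `|Rd (n0 + n)%N M om| <= n.+1%:R^-1 &
    forall om K, (forall t, 0 <= t <= T -> forall z, `|val (phi t om) z| <= K * bracket2 R (val z) ^+ N) ->
    `|Rt (n0 + n)%N M om| <= K * E / (n0 + n).+1%:R].
  have xn := Hn0 (n0 + n)%N (leq_addr _ _).
  have e0 : 0 < n.+1%:R^-1 :> R by rewrite invr_gt0.
  have H1 := noise_bound _ _ xn e0; have H3 := HE _ xn.
  have /cvgrPdist_le/(_ _ e0) H2 := Rd_cvg _ xn.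
  near \oo%classic => M; exists M; split.
  - by near: M.
  - have : `|0 - \int[P]_om Num.min 2 `|Rd (n0 + n)%N M om| | <= n.+1%:R^-1 by near: M.
    by rewrite sub0r normrN; apply: le_trans; exact: ler_norm.
  - by near: M.
have [M HM] := choice pick.
pose Z n := expR (- (k * th ^+ 2 * (I - E2 / (n0 + n).+1%:R - n.+1%:R^-1))) +
  \int[P]_om Num.min 2 `|Rt (n0 + n)%N (M n) om| + n.+1%:R^-1.
have leZ n : `|\int[P]_om cos (th * val (phi T om) x)| <= Z n.
  have [H1 H2 _] := HM n; rewrite /Z.
  pose z om := mean (n0 + n)%N (M n) + noise (n0 + n)%N (M n) om.
  pose mt om := Num.min 2 `|Rt (n0 + n)%N (M n) om|.
  pose md om := Num.min 2 `|Rd (n0 + n)%N (M n) om|.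
  have min_int (g : Om -> R) : measurable_fun setT g ->
      P.-integrable setT (EFin \o (fun om => Num.min 2 `|g om|)).
    move=> mg; apply: (@bounded_integrable _ _ _ P 2).
      by apply: measurable_minr => //; exact: measurableT_comp.
    by move=> om; rewrite ger0_norm; [rewrite ge_min lexx|rewrite le_min normr_ge0 ler0n].
  have mphi : measurable_fun setT (fun om => th * val (phi T om) x).
    by apply: measurable_funM => //; exact: (solution_measurable sol x (ltW T0)).
  have ic1 := cos_integrable P mphi.
  have ic2 : P.-integrable setT (EFin \o (fun om => cos (z om))) := cos_integrable P (mN _ _).
  have it := min_int _ (mRt (n0 + n)%N (M n)); have id := min_int _ (mRd (n0 + n)%N (M n)).
  have Hd : `|\int[P]_om cos (th * val (phi T om) x) - \int[P]_om cos (z om)| <=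
      \int[P]_om mt om + \int[P]_om md om.
    rewrite -RintegralB// -RintegralD//.
    have ib : P.-integrable setT (EFin \o (fun om => cos (th * val (phi T om) x) - cos (z om))).
      exact: (integrableB measurableT ic1 ic2).
    apply: le_trans (le_normr_Rintegral measurableT ib) _.
    apply: le_Rintegral => //.
    - exact: (integrable_norm ib).
    - exact: (integrableD measurableT it id).
    - by move=> om _; exact: (cos_sub_le phi0 phi x T th).
  have := ler_normD (\int[P]_om cos (th * val (phi T om) x) - \int[P]_om cos (z om)) (\int[P]_om cos (z om)).
  rewrite subrK => Ht; apply: le_trans Ht _.
  apply: le_trans (lerD Hd H1) _; rewrite addrC addrA lerD2l //.
have Rt_cvg : \int[P]_om Num.min 2 `|Rt (n0 + n)%N (M n) om| @[n --> \oo] --> (0 : R).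
  apply: (@bounded_cvg0 _ _ R P (fun n om => Num.min 2 `|Rt (n0 + n)%N (M n) om|) 2).
  - move=> n; apply: measurable_minr => //; exact: measurableT_comp.
  - move=> n om; rewrite ger0_norm; first by rewrite ge_min lexx.
    by rewrite le_min normr_ge0 ler0n.
  apply: filterS Hcont => om Hc.
  have [K HK] := Hneg_path_bounded T Hc.
  apply/cvgrPdist_le => e e0; near=> n.
  rewrite sub0r normrN ger0_norm ?le_min ?normr_ge0 ?ler0n//.
  rewrite ge_min; apply/orP; right.
  have [_ _ H] := HM n; apply: le_trans (H om K HK) _.
  rewrite ler_pdivrMr ?ltr0n//; apply: (@le_trans _ _ (e * n%:R)); last first.
    by rewrite ler_pM2l// ler_nat; apply: leq_trans (leq_addl n0 n) (leqnSn _).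
  rewrite [e * _]mulrC -ler_pdivrMr//; apply: ltW; near: n; exact: nbhs_infty_gtr.
have cvgZ : Z @ \oo --> expR (- (k * th ^+ 2 * I)).
  rewrite -[expR _]addr0 -[X in _ --> X]addr0.
  have inv_cvg : (n.+1%:R^-1 : R) @[n --> \oo] --> (0 : R) := cvg_harmonic.
  have inv_cvg0 : ((n0 + n).+1%:R^-1 : R) @[n --> \oo] --> (0 : R).
    apply/cvgrPdist_le => e e0.
    have /cvgrPdist_le/(_ _ e0) := inv_cvg; apply: filterS => n.
    rewrite !sub0r !normrN !gtr0_norm ?invr_gt0// => h; apply: le_trans _ h.
    by rewrite lef_pV2 ?posrE// ler_nat ltnS leq_addl.
  apply: cvgD => //; apply: cvgD => //.
  apply: (@continuous_cvg _ _ _ _ _ _ (@expR R)); first exact: continuous_expR.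
  apply: cvgN; apply: cvgM; first exact: cvg_cst.
  rewrite -[X in _ --> X]subr0 -[X in _ --> X - 0]subr0.
  apply: cvgB => //; apply: cvgB; first exact: cvg_cst.
  by rewrite -[X in _ --> X](mulr0 E2); apply: cvgM => //; exact: cvg_cst.
rewrite -(cvg_lim _ cvgZ)//; apply: limr_ge; first by apply/cvg_ex; eexists; exact: cvgZ.
exact: nearW.
Unshelve. all: by end_near. Qed.

End cos_sde.

(** * Stationary measures *)

Section tempered.
Variables (R : realType) (d : nat) (C : set (Zd d)).

Lemma measurable_eval (x : C) : measurable_fun setT (fun phi : SprimeType R C => val phi x).
Proof.
move=> _ E mE; rewrite setTI; apply: sub_sigma_algebra.
by exists x, E.
Qed.

(** One integer serves as constant and as exponent, so that these sets increase and exhaust the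
    space of tempered functions. *)
Definition growth_set (j : nat) : set (SprimeType R C) :=
  [set phi | forall x : C, `|val phi x| <= j.+1%:R * bracket2 R (val x) ^+ j].

Lemma growth_set_measurable j : measurable (growth_set j).
Proof.
rewrite (_ : growth_set j = \bigcap_n \big[setI/setT]_(x <- box C n)
   ((fun phi : SprimeType R C => val phi x) @^-1`
     [set r | `|r| <= j.+1%:R * bracket2 R (val x) ^+ j])).
  apply: bigcapT_measurable => n; apply: bigsetI_measurable => x _.
  rewrite -(setTI (_ @^-1` _)); apply: measurable_eval => //.
  rewrite (_ : [set r | _] = `[- (j.+1%:R * bracket2 R (val x) ^+ j),
      j.+1%:R * bracket2 R (val x) ^+ j]%classic); first exact: measurable_itv.
  by apply/seteqP; split => r /=; rewrite in_itv /= ler_norml.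
apply/seteqP; split => phi.
  move=> H n _; elim: (box C n) => [|x s IH]; first by rewrite big_nil.
  by rewrite big_cons; split => //=; exact: H.
move=> H x; have [n /(_ _ (leqnn n)) xn] := mem_box_ex x.
have := H n I; elim: (box C n) xn => [//|y s IH].
rewrite inE big_cons => /orP[/eqP->|xs] [H1 H2]; first exact: H1.
exact: IH.
Qed.

Lemma growth_set_nd : nondecreasing_seq growth_set.
Proof.
move=> i j ij; apply/subsetPset => phi H x; apply: le_trans (H x) _.
have V1 := bracket2_ge1 R (val x).
apply: ler_pM => //; first by rewrite exprn_ge0// ltW// bracket2_gt0.
  by rewrite ler_nat.
exact: ler_weXn2l.
Qed.

Lemma bigcup_growth_set : \bigcup_j growth_set j = setT.
Proof.
apply/seteqP; split => // phi _.
have /set_mem[N _ HN] := valP phi.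
have [r [r0 Hr]] : exists r : R, 0 <= r /\ (Hneg_norm2 N (val phi) <= r%:E)%E.
  have H0 : (0 <= Hneg_norm2 N (val phi))%E.
    apply: esum_ge0 => z _; rewrite lee_fin mulr_ge0// ?exprn_ge0//.
    by rewrite invr_ge0 exprn_ge0// /jbracket sqrtr_ge0.
  by move: HN H0; rewrite /Hneg /=; case: (Hneg_norm2 _ _) => // r _ r0; exists r.
exists (maxn N (Num.trunc r).+1) => // x.
have V1 := bracket2_ge1 R (val x).
have A : `|val phi x| <= (1 + r) * bracket2 R (val x) ^+ N.
  apply: sqr_le_weight => //; first by rewrite exprn_ege1.
  by rewrite -lee_fin; exact: le_trans (le_Hneg_norm2 N _ x) Hr.
apply: le_trans A _; apply: ler_pM.
- by rewrite addr_ge0.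
- by rewrite exprn_ge0// ltW// bracket2_gt0.
- rewrite -[leRHS]nat1r lerD2l; apply: (@le_trans _ _ (Num.trunc r).+1%:R).
    exact/ltW/Num.Theory.truncnS_gt.
  by rewrite ler_nat leq_maxr.
- by apply: ler_weXn2l => //; rewrite leq_maxl.
Qed.

Lemma growth_set_mass (mu : probability (SprimeType R C) R) (e : R) : 0 < e ->
  exists j, 1 - e <= fine (mu (growth_set j)).
Proof.
move=> e0.
have H : mu (growth_set j) @[j --> \oo] --> mu (\bigcup_j growth_set j).
  apply: nondecreasing_cvg_mu.
  - exact: growth_set_measurable.
  - by rewrite bigcup_growth_set; exact: measurableT.
  - exact: growth_set_nd.
rewrite bigcup_growth_set probability_setT in H.
have /fine_cvgP[_ /cvgrPdist_le/(_ _ e0)] := H.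
move=> [n _ /(_ n (leqnn n))] /=; rewrite ler_norml => /andP[_ ?].
by exists n; lra.
Qed.

(** The exponent 2j cancels the squared growth, and the additional d leaves the summable weight
    <x>^(-2d). *)
Lemma poly_growth_Sprime (f : C -> R) A j : 0 <= A ->
  (forall x, `|f x| <= A * bracket2 R (val x) ^+ j) -> Sprime f.
Proof.
move=> A0 fA; exists (2 * j + d)%N => //; rewrite /Hneg /=.
apply: (@le_lt_trans _ _ (A ^+ 2 * 8 ^+ d)%:E); last exact: ltry.
apply/ge_ereal_sup => _ [S [finS _] <-].
rewrite fsbig_finite//= sumEFin lee_fin.
set s := finmap.enum_fset _; have us : uniq s by exact: finmap.fset_uniq.
have [n sn] := seq_sub_box s.
apply: (@le_trans _ _ (\sum_(x <- s) A ^+ 2 * (bracket2 R (val x) ^+ d)^-1)).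
  apply: ler_sum => x _; rewrite exprM jbracket_sqr exprD.
  have V0 := bracket2_gt0 R (val x).
  rewrite mulrC ler_pdivrMr; last by rewrite mulr_gt0 ?exprn_gt0.
  have -> : A ^+ 2 / bracket2 R (val x) ^+ d *
      (bracket2 R (val x) ^+ (2 * j) * bracket2 R (val x) ^+ d) =
      (A * bracket2 R (val x) ^+ j) ^+ 2.
    rewrite mulnC exprM; field.
    by rewrite expf_neq0// gt_eqF.
  by rewrite lerXn2r ?nnegrE// mulr_ge0// exprn_ge0// ltW.
rewrite -mulr_sumr ler_wpM2l ?sqr_ge0//.
apply: le_trans (sum_box_bracket2 R C n); apply: sum_uniq_sub => //.
  exact: box_uniq.
by move=> x; rewrite invr_ge0 exprn_ge0// ltW// bracket2_gt0.
Qed.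

End tempered.

Theorem theorem2p8 (R : realType) (d : nat) (w : Zd d -> Zd d -> R)
    (C : set (Zd d))
    (dX : measure_display) (OmX : measurableType dX)
    (PX : C -> probability OmX R) (X : R -> OmX -> C)
    (dO : measure_display) (Om : measurableType dO) (P : probability Om R)
    (Fil : R -> set (set Om)) (B : C -> R -> Om -> R)
    (Phi : SprimeType R C -> R -> Om -> SprimeType R C) :
  (1 <= d)%N ->
  conductances w ->
  unique_infinite_component w C ->
  variable_speed_random_walk w PX X ->
  filtration Fil ->
  independent_brownian_motions P Fil B ->
  (forall phi0, sde_solution w P Fil B phi0 (Phi phi0)) ->
  growth_assumption w ->
  ~ is_Sprime_function (fun x : C => green PX X x x) ->
  ~ exists mu : probability (SprimeType R C) R,
      stationary (semigroup P Phi) mu.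
Proof.
move=> _ cw _ vX filF bmB sol gw nG [mu stat]; apply: nG.
have [k k0 Hk] := cos_sde_bound cw gw vX filF bmB.
have c0 := cos1_gt0 R; have c1 := cos_le1 (1 : R).
(* With this loss of mass, (cos 1 + 1)(1 - cos 1 / 4) - 1 is still at least cos 1 / 2, because cos 1
   <= 1. *)
have [j muj] := @growth_set_mass R d C mu (cos 1 / 4) (divr_gt0 c0 (ltr0n _ 4)).
(* Obtained by solving k th^2 I cos 1 <= 2 for I, with th the inverse of (j+1) <x>^(2j). *)
pose A : R := 2 / (cos 1 * k) * j.+1%:R ^+ 2.
have A0 : 0 <= A by rewrite mulr_ge0 ?sqr_ge0// divr_ge0// mulr_ge0// ltW.
have greenA (x : C) : (green PX X x x <= (A * bracket2 R (val x) ^+ (2 * j))%:E)%E.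
  apply: (green_le cw vX) => T T0.
  set I := \int[lebesgue_measure]_(s in _) _.
  have I0 : 0 <= I by apply: Rintegral_ge0 => s _; rewrite heat_ge0.
  have V0 : 0 < bracket2 R (val x) ^+ j by rewrite exprn_gt0// bracket2_gt0.
  pose L := j.+1%:R * bracket2 R (val x) ^+ j; have L0 : 0 < L by rewrite mulr_gt0.
  pose th := L^-1.
  pose F (phi : SprimeType R C) : R := cos (th * val phi x).
  have mth : measurable_fun setT (fun phi : SprimeType R C => th * val phi x).
    by apply: measurable_funM => //; exact: measurable_eval.
  have mF : measurable_fun setT F by exact: measurable_cos_comp.
  have upper : `|\int[mu]_phi F phi| <= expR (- (k * th ^+ 2 * I)).
    rewrite -(stat F mF _ T (ltW T0)); last by exists 1 => phi; exact: cos_max.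
    apply: Rintegral_le_cst => phi0.
    exact: (Hk phi0 (Phi phi0) (sol phi0) x T th T0).
  have lower : cos 1 / 2 <= \int[mu]_phi F phi.
    pose G := growth_set j : set (SprimeType R C).
    have mG : measurable G by exact: growth_set_measurable.
    have iG : mu.-integrable setT (EFin \o (fun phi => \1_G phi : R)).
      apply: (@bounded_integrable _ _ _ mu 1) => [|phi]; first exact: measurable_indic.
      by rewrite indicE; case: (_ \in _); rewrite ?normr1 ?normr0.
    have iG1 : mu.-integrable setT (EFin \o (fun phi => (cos 1 + 1) * \1_G phi : R)).
      exact: (integrableZl measurableT (cos 1 + 1) iG).
    have i1 : mu.-integrable setT (EFin \o (fun=> 1 : R)).
      by apply: (@bounded_integrable _ _ _ mu 1) => // phi; rewrite normr1.
    (* The minorant equals cos 1 on the growth set, where the argument is at most 1 in absolute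
       value, and -1 elsewhere. *)
    apply: (@le_trans _ _ (\int[mu]_phi ((cos 1 + 1) * \1_G phi - 1))).
      rewrite RintegralB// RintegralZl// Rintegral_indic_prob// Rintegral_cst_prob.
      have : (cos 1 + 1) * (1 - cos 1 / 4) <= (cos 1 + 1) * fine (mu G) by rewrite ler_pM2l//; lra.
      by move: (fine (mu G)) => g; nra.
    apply: le_Rintegral => //.
    - exact: (integrableB measurableT iG1 i1).
    - exact: cos_integrable.
    move=> phi _; rewrite indicE /F; case: (boolP (phi \in G)) => phiG.
      rewrite mulr1 addrK; apply: cos1_le_cos.
      rewrite normrM gtr0_norm ?invr_gt0// mulrC ler_pdivrMr// mul1r.
      exact: (set_mem phiG).
    by rewrite mulr0 sub0r; exact: cos_geN1.
  have s0 : 0 <= k * th ^+ 2 * I by rewrite mulr_ge0// mulr_ge0 ?sqr_ge0// ltW.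
  (* From cos 1 / 2 <= exp(-s) and 1 + s <= exp(s), the product gives (cos 1 / 2)(1 + s) <= 1. *)
  have s1 : k * th ^+ 2 * I * cos 1 <= 2.
    have h1 : cos 1 / 2 <= expR (- (k * th ^+ 2 * I)).
      exact: le_trans lower (le_trans (ler_norm _) upper).
    have h2 := expR_ge1Dx (k * th ^+ 2 * I).
    have h3 : expR (- (k * th ^+ 2 * I)) * expR (k * th ^+ 2 * I) = 1.
      by rewrite -expRD addNr expR0.
    move: h1 h2 h3 s0; move: (k * th ^+ 2 * I) => s.
    move: (expR (- s)) (expR s) => a b h1 h2 h3 s0.
    have h4 : cos 1 / 2 * b <= a * b by rewrite ler_wpM2r//; lra.
    have h5 : cos 1 / 2 * (1 + s) <= cos 1 / 2 * b by rewrite ler_pM2l// divr_gt0.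
    by rewrite h3 in h4; lra.
  have -> : A * bracket2 R (val x) ^+ (2 * j) = 2 / (cos 1 * k) * L ^+ 2.
    by rewrite /A /L exprMn mulnC exprM; ring.
  rewrite mulrAC ler_pdivlMr ?mulr_gt0//.
  have -> : I * (cos 1 * k) = k * th ^+ 2 * I * cos 1 * L ^+ 2.
    by rewrite /th; field; rewrite gt_eqF.
  by rewrite ler_wpM2r// sqr_ge0.
have green0 (x : C) : (0 <= green PX X x x)%E by exact: integral_ge0.
(* The bound makes the Green function finite, so [fine] does not return its default value. *)
have greenE (x : C) : green PX X x x = (fine (green PX X x x))%:E.
  by rewrite fineK// ge0_fin_numE// (le_lt_trans (greenA x))// ltry.
exists (fun x : C => fine (green PX X x x)) => //.
apply: (poly_growth_Sprime A0 (j := (2 * j)%N)) => x.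
by rewrite ger0_norm ?fine_ge0// -lee_fin -greenE.
Qed.
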